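(* Let $R\ge1$ be an integer and let $p,q,\alpha,\beta\in(0,1)$ satisfy $p\beta<q\alpha$ and $$\frac{\alpha}{1-\alpha}\,\frac{p}{1-p}=\frac{\beta}{1-\beta}\,\frac{q}{1-q}.$$ Consider $R$ batch queues in tandem (defined in the context), where the service processes $(S^{(r)}_n)_{n\in\mathbb{Z}}$, $r=1,\dots,R$, are mutually independent, each consisting of i.i.d. $\mathrm{Ber}(q)\mathrm{Geom}(\beta)$ random variables, and where the arrival process $(A^{(1)}_n)_{n\in\mathbb{Z}}$ to the first queue consists of i.i.d. $\mathrm{Ber}(p)\mathrm{Geom}(\alpha)$ random variables and is independent of all the service processes. Then: (i) All the departure processes $(D^{(r)}_n)_{n\in\mathbb{Z}}$, $r=1,\dots,R$, have the same distribution, which is also the distribution of $(A^{(1)}_n)_{n\in\mathbb{Z}}$. (ii) For each fixed time $n\in\mathbb{Z}$, the queue lengths $X^{(1)}_n,X^{(2)}_n,\dots,X^{(R)}_n$ are i.i.d. random variables, with common distribution $\mathrm{Ber}(c)\mathrm{Geom}(\gamma)$, where $$c=\frac{\beta}{1-\beta}\,\frac{1-\alpha}{\alpha},\qquad \gamma=\frac{\alpha-\beta}{1-\beta}.$$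
   Context: For $p\in[0,1]$ and $\alpha\in(0,1)$, a random variable $A$ has distribution $\mathrm{Ber}(p)\mathrm{Geom}(\alpha)$ if $\mathbb{P}(A=0)=1-p$ and $\mathbb{P}(A=k)=p\alpha(1-\alpha)^{k-1}$ for integers $k\ge1$. Batch queue: given arrivals $(A_n)_{n\in\mathbb{Z}}$ and services $(S_n)_{n\in\mathbb{Z}}$, the queue length before the arrival at time $n$ is $$X_n=\max_{m\le n}\sum_{r=m}^{n-1}(A_r-S_r)$$ (maximum over integers $m\le n$, with an empty sum equal to $0$), which satisfies $X_{n+1}=\max\{X_n+A_n-S_n,0\}$. The number of departures at time $n$ is $D_n=\min(X_n+A_n,S_n)$. Tandem: queue $r$ has arrivals $A^{(r)}_n$, services $S^{(r)}_n$, queue length $X^{(r)}_n$ and departures $D^{(r)}_n$, defined from $(A^{(r)}_n)$ and $(S^{(r)}_n)$ by $$X^{(r)}_n=\max_{m\le n}\sum_{k=m}^{n-1}\bigl(A^{(r)}_k-S^{(r)}_k\bigr),\qquad D^{(r)}_n=\min\bigl(X^{(r)}_n+A^{(r)}_n,\,S^{(r)}_n\bigr)$$ (maximum over integers $m\le n$, with an empty sum equal to $0$); and for $r=2,\dots,R$ the arrival process is the departure process of the previous queue in the same time slot, $A^{(r)}_n=D^{(r-1)}_n$. *)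

(* Defs.v *)
From HB Require Import structures.
From mathcomp Require Import all_boot all_order all_algebra.
From mathcomp Require Import finmap.
From mathcomp Require Import all_classical all_reals all_analysis.
From mathcomp Require Import measurable_realfun.

Set Implicit Arguments.
Unset Strict Implicit.
Unset Printing Implicit Defensive.

Import Order.TTheory GRing.Theory Num.Theory.
Import numFieldNormedType.Exports.

Local Open Scope classical_set_scope.
Local Open Scope ring_scope.

(* Queue lengths are suprema over an infinite past, so they live in \bar R;
   for uniformity so do arrivals, services and departures. *)
Definition counts {d : measure_display} {T : measurableType d} {R : realType}
    {P : probability T R} (Y : int -> {RV P >-> nat}) : int -> T -> \bar R :=
  fun n w => ((Y n w)%:R)%:E.

Definition queues (N : nat) : set nat := [set r | (1 <= r <= N)%N].

Section queue.
Context {R : realType}.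
Implicit Types (a s : int -> \bar R) (m n : int).

(* \sum_(k = m)^(n - 1) (a_k - s_k), meant for m <= n *)
Definition net_input a s m n : \bar R :=
  (\sum_(0 <= i < absz (n - m)%R) (a (m + i%:Z)%R - s (m + i%:Z)%R))%E.

(* When a and s take (finite) integer values this is the maximum if that
   maximum exists, and +oo otherwise. *)
Definition queue_length a s n : \bar R :=
  ereal_sup [set net_input a s m n | m in [set m : int | m <= n]].

Definition departures a s n : \bar R :=
  Order.min (queue_length a s n + a n)%E (s n).

End queue.

Section tandem.
Context {R : realType} {T : Type}.
Variables (A : int -> T -> \bar R) (S : nat -> int -> T -> \bar R).

(* Queues are numbered from 1, as are the service processes S 1, S 2, ...
   (S 0 is not used); the 0-th departure process is the external arrival
   process A, so that queue r has arrivals tandem_departures r.-1. *)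
Fixpoint tandem_departures (r : nat) : int -> T -> \bar R :=
  if r is r'.+1 then
    fun n w => departures (fun k => tandem_departures r' k w)
                          (fun k => S r'.+1 k w) n
  else A.

Definition tandem_queue_length (r : nat) (n : int) (w : T) : \bar R :=
  queue_length (fun k => tandem_departures r.-1 k w) (fun k => S r k w) n.

End tandem.

Section laws.
Context {d : measure_display} {T : measurableType d} {R : realType}.
Variable P : probability T R.

Definition ber_geom_pmf (p a : R) (k : nat) : R :=
  if k is j.+1 then p * a * (1 - a) ^+ j else 1 - p.

Definition ber_geom (p a : R) (X : T -> \bar R) : Prop :=
  measurable_fun setT X /\
  forall k : nat, P [set w | X w = (k%:R)%:E] = (ber_geom_pmf p a k)%:E.

Definition sigma_var (X : T -> \bar R) : set (set T) :=
  preimage_set_system setT X measurable.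

Definition sigma_process (X : int -> T -> \bar R) : set (set T) :=
  <<s \bigcup_n sigma_var (X n) >>.

Definition mutual_independence (I : choiceType) (D : set I)
    (F : I -> set (set T)) : Prop :=
  (forall i, D i -> F i `<=` measurable) /\
  forall (J : {fset I}) (E : I -> set T), [set` J] `<=` D ->
    (forall i, i \in J -> F i (E i)) ->
    P (\bigcap_(i in [set` J]) E i) = (\prod_(i <- J) P (E i))%E.

Definition independence (F G : set (set T)) : Prop :=
  [/\ F `<=` measurable, G `<=` measurable &
   forall E E', F E -> G E' -> P (E `&` E') = (P E * P E')%E].

Definition iid_ber_geom (I : choiceType) (D : set I) (p a : R)
    (X : I -> T -> \bar R) : Prop :=
  mutual_independence D (fun i => sigma_var (X i)) /\
  forall i, D i -> ber_geom p a (X i).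

(* the product sigma-algebra on the path space (\bar R)^Z *)
Definition path_measurable : set (set (int -> \bar R)) :=
  <<s \bigcup_n [set (fun x : int -> \bar R => x n) @^-1` B |
                 B in measurable] >>.

Definition same_law (X Y : int -> T -> \bar R) : Prop :=
  [/\ forall n, measurable_fun setT (X n),
      forall n, measurable_fun setT (Y n) &
      forall B, path_measurable B ->
        P [set w | B (X ^~ w)] = P [set w | B (Y ^~ w)]].

End laws.

(* Main.v *)
Require Import Defs.
From HB Require Import structures.
From mathcomp Require Import all_boot all_order all_algebra.
From mathcomp Require Import finmap.
From mathcomp Require Import all_classical all_reals all_analysis.
From mathcomp Require Import measurable_realfun.
From mathcomp Require Import ring lra zify.

Set Implicit Arguments.
Unset Strict Implicit.
Unset Printing Implicit Defensive.

Import Order.TTheory GRing.Theory Num.Theory.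
Import numFieldNormedType.Exports.

Local Open Scope classical_set_scope.
Local Open Scope ring_scope.

(* Burke's argument without time reversal. Write pi for the Ber(c)Geom(gamma)
   law. The balance condition makes one time slot preserve products: if X ~ pi is
   independent of (A, S), then max(X + A - S, 0) ~ pi and min(X + A, S) ~ A are
   independent. Hence, if X_m ~ pi is independent of the arrivals and services
   from time m on, then the departures D_m, ..., D_(n-1) are i.i.d. with the law
   of A and independent of X_n.

   That X_n ~ pi is a Liouville argument. The distribution function G of pi is
   harmonic for y |-> y + S - A killed below 0, and G is below the distribution
   function F of every queue started empty, hence of X_n. Since F - G tends to 0 at
   infinity and from every y the killing has positive probability, iterating the
   harmonic equation forces F = G; in particular X_n is almost surely finite.

   For the tandem, conditioning on the queue lengths X^(1)_n, ..., X^(r)_n and on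
   the services of the queues beyond r + 1 leaves the inputs of queue r + 1 before
   time n i.i.d., so the single-queue result can be applied again. *)

(** * The one-slot balance identities *)

Section ber_geom_laws.
Context {R : realType}.
Implicit Types (p a : R) (k : nat).

(** The tail is that of the weak inequality $X \ge k$, hence the value 1 at 0 and the shift by one
    in [ber_geom_cdf]. *)
Definition ber_geom_tail p a k : R := if k is j.+1 then p * (1 - a) ^+ j else 1.

Definition ber_geom_cdf p a k : R := 1 - ber_geom_tail p a k.+1.

Lemma ber_geom_tail_pmf p a k :
  ber_geom_tail p a k = ber_geom_pmf p a k + ber_geom_tail p a k.+1.
Proof.
case: k => [|k] /=; first by rewrite expr0 mulr1; ring.
by rewrite exprS; ring.
Qed.

Lemma sum_ber_geom_pmf p a k :
  \sum_(i < k) ber_geom_pmf p a i = 1 - ber_geom_tail p a k.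
Proof.
elim: k => [|k IH]; first by rewrite big_ord0 /= subrr.
by rewrite big_ord_recr /= IH ber_geom_tail_pmf /=; ring.
Qed.

Lemma ber_geom_pmf_ge0 p a k : 0 <= p <= 1 -> 0 <= a <= 1 ->
  0 <= ber_geom_pmf p a k.
Proof.
move=> hp ha; case: k => [|k] /=; first lra.
by rewrite mulr_ge0 ?exprn_ge0 ?mulr_ge0; lra.
Qed.

Lemma ber_geom_tail_ge0 p a k : 0 <= p <= 1 -> 0 <= a <= 1 ->
  0 <= ber_geom_tail p a k.
Proof.
move=> hp ha; case: k => [|k] //=.
by rewrite mulr_ge0 ?exprn_ge0; lra.
Qed.

Lemma ber_geom_cdfS p a k :
  ber_geom_cdf p a k.+1 = ber_geom_cdf p a k + ber_geom_pmf p a k.+1.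
Proof. by rewrite /ber_geom_cdf (ber_geom_tail_pmf _ _ k.+1); ring. Qed.

Lemma ber_geom_cdf0 p a : ber_geom_cdf p a 0 = ber_geom_pmf p a 0.
Proof. by rewrite /ber_geom_cdf /= expr0 mulr1. Qed.

Lemma ber_geom_cdf_ge0 p a k : 0 <= p <= 1 -> 0 <= a <= 1 ->
  0 <= ber_geom_cdf p a k.
Proof.
move=> hp ha; rewrite /ber_geom_cdf -sum_ber_geom_pmf.
by apply: sumr_ge0 => i _; exact: ber_geom_pmf_ge0.
Qed.

Lemma ber_geom_tail_cvg0 p a (eps : R) : 0 <= p <= 1 -> 0 < a <= 1 -> 0 < eps ->
  \forall k \near \oo, ber_geom_tail p a k < eps.
Proof.
move=> hp ha e0.
have := @cvg_expr R (1 - a); rewrite ger0_norm; last by lra.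
move=> /(_ ltac:(lra)) /cvgr_lt => /(_ eps e0) /= [N _ hN].
exists N.+1 => // -[//|k] /= Nk.
have := hN k Nk; apply: le_lt_trans.
by rewrite ler_piMl ?exprn_ge0; lra.
Qed.

End ber_geom_laws.

Definition queue_ber {R : realType} (alpha beta : R) : R :=
  beta / (1 - beta) * ((1 - alpha) / alpha).

Definition queue_geom {R : realType} (alpha beta : R) : R :=
  (alpha - beta) / (1 - beta).

Record stable_balance {R : realType} (p q alpha beta : R) : Prop := StableBalance {
  balance_p : 0 < p < 1;
  balance_q : 0 < q < 1;
  balance_alpha : 0 < alpha < 1;
  balance_beta : 0 < beta < 1;
  balance_lt : p * beta < q * alpha;
  balance_eq : alpha / (1 - alpha) * (p / (1 - p)) =
               beta / (1 - beta) * (q / (1 - q)) }.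

Section balance.
Context {R : realType} (p q alpha beta : R).
Hypothesis bal : stable_balance p q alpha beta.

Let c := queue_ber alpha beta.
Let g := queue_geom alpha beta.
(* The queue length plus the next arrival is Ber(v)Geom(g): adding the two
   laws cancels the pole of the generating function of the arrival. *)
Let v := c + p - c * p.

Lemma balance_poly :
  alpha * p * ((1 - beta) * (1 - q)) = beta * q * ((1 - alpha) * (1 - p)).
Proof.
case: bal => hp hq ha hb _ e.
pose K := (1 - alpha) * (1 - p) * ((1 - beta) * (1 - q)).
transitivity (alpha / (1 - alpha) * (p / (1 - p)) * K).
  by rewrite /K; field; lra.
by rewrite e /K; field; lra.
Qed.

(** If $\alpha \le \beta$, then $p\beta < q\alpha \le q\beta$ gives $p < q$. So the odds of $\alpha$
    are at most those of $\beta$ and the odds of $p$ are below those of $q$, against the balance of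
    the products. *)
Lemma balance_rate_lt : beta < alpha.
Proof.
case: (bal) => hp hq ha hb hlt _; have heq := balance_poly.
rewrite ltNge; apply/negP => ab.
have pq : p < q by nra.
have h1 : alpha * (1 - beta) <= beta * (1 - alpha) by nra.
have h2 : p * (1 - q) < q * (1 - p) by nra.
have h3 : 0 < p * (1 - q) by nra.
have h4 : 0 < beta * (1 - alpha) by nra.
have : alpha * (1 - beta) * (p * (1 - q)) <
       beta * (1 - alpha) * (q * (1 - p)).
  apply: (@le_lt_trans _ _ (beta * (1 - alpha) * (p * (1 - q)))).
    by rewrite ler_pM2r.
  by rewrite ltr_pM2l.
have -> : alpha * (1 - beta) * (p * (1 - q)) =
   alpha * p * ((1 - beta) * (1 - q)) by ring.
rewrite heq.
have -> : beta * (1 - alpha) * (q * (1 - p)) =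
   beta * q * ((1 - alpha) * (1 - p)) by ring.
by rewrite ltxx.
Qed.

Lemma queue_berM : c * (alpha * (1 - beta)) = beta * (1 - alpha).
Proof. by case: bal => *; rewrite /c /queue_ber; field; lra. Qed.

Lemma queue_geomM : (1 - g) * (1 - beta) = 1 - alpha.
Proof. by case: bal => *; rewrite /g /queue_geom; field; lra. Qed.

(** In this form the generating function of Ber(c)Geom(g) has numerator $(1-c)(1-(1-\alpha)z)$,
    whose zero is the pole of the generating function of an arrival. *)
Lemma queue_geomE : g = (1 - c) * alpha.
Proof.
have h1b : 1 - beta != 0 by case: bal => *; lra.
apply: (mulIf h1b); transitivity (alpha * (1 - beta) - beta * (1 - alpha)).
  transitivity ((1 - beta) - (1 - g) * (1 - beta)); first by ring.
  by rewrite queue_geomM; ring.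
by rewrite -queue_berM; ring.
Qed.

Lemma queue_ber_itv : 0 < c < 1.
Proof.
case: (bal) => hp hq ha hb _ _; have := balance_rate_lt; have := queue_berM.
have : 0 < alpha * (1 - beta) by nra.
have : 0 < beta * (1 - alpha) by nra.
by move=> *; apply/andP; split; nra.
Qed.

Lemma queue_geom_itv : 0 < g < 1.
Proof.
case: (bal) => hp hq ha hb _ _; have := balance_rate_lt; have := queue_geomM.
by move=> *; apply/andP; split; nra.
Qed.

(** This identity, [balance_massS] and [balance_idle] are the one-slot product form with the powers
    stripped off. The cases are: no departure and a nonempty queue left, some departures and a
    nonempty queue left, some departures and an empty queue left. *)
Lemma balance_mass0 : v * (1 - q) = c * (1 - p).
Proof.
have hM : alpha * (1 - beta) != 0.
  by case: bal => *; rewrite mulf_neq0 //; lra.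
apply: (mulIf hM); rewrite /v; have hc := queue_berM; have hp := balance_poly.
have -> : (c + p - c * p) * (1 - q) * (alpha * (1 - beta)) =
  c * (alpha * (1 - beta)) * (1 - p) * (1 - q)
  + alpha * p * ((1 - beta) * (1 - q)) by ring.
have -> : c * (1 - p) * (alpha * (1 - beta)) =
  c * (alpha * (1 - beta)) * (1 - p) by ring.
by rewrite hp hc; ring.
Qed.

Lemma balance_massS : v * (1 - g) * (q * beta) = c * p * alpha.
Proof.
case: (bal) => hp hq ha hb _ _.
have h1q : 1 - q != 0 by lra.
have h1b : 1 - beta != 0 by lra.
apply: (mulIf h1q); apply: (mulIf h1b).
have -> : v * (1 - g) * (q * beta) * (1 - q) * (1 - beta) =
  v * (1 - q) * ((1 - g) * (1 - beta)) * (q * beta) by ring.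
rewrite balance_mass0 queue_geomM.
have -> : c * p * alpha * (1 - q) * (1 - beta) =
  c * (alpha * p * ((1 - beta) * (1 - q))) by ring.
by rewrite balance_poly; ring.
Qed.

Lemma balance_idle : v * g * q = (1 - c) * p * alpha.
Proof.
have -> : v * g * q = g * (v - v * (1 - q)) by ring.
by rewrite balance_mass0 queue_geomE /v; ring.
Qed.

Lemma queue_arrival_conv n :
  \sum_(x < n.+1) ber_geom_pmf c g x * ber_geom_pmf p alpha (n - x)
  = ber_geom_pmf v g n.
Proof.
case: n => [|n].
  by rewrite big_ord_recl big_ord0 /= /v; ring.
rewrite big_ord_recl big_ord_recr /=.
rewrite (_ : (n.+1 - bump 0 n)%N = 0%N); last by rewrite /bump; lia.
have -> : \sum_(i < n) ber_geom_pmf c g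
     (bump 0 (widen_ord (leqnSn n) i)) *
     ber_geom_pmf p alpha (n.+1 - bump 0 (widen_ord (leqnSn n) i)) =
   c * g * (p * alpha) * \sum_(i < n) (1 - alpha) ^+ (n.-1 - i) * (1 - g) ^+ i.
  rewrite mulr_sumr; apply: eq_bigr => i _.
  have -> : bump 0 (widen_ord (leqnSn n) i) = i.+1 by [].
  have -> : (n.+1 - i.+1)%N = (n.-1 - i).+1 by have := ltn_ord i; lia.
  by rewrite /=; ring.
(* The terms between the two extreme ones form a geometric sum. Multiplying by the difference of the
   ratios turns it into a difference of powers; the factor is nonzero as $\beta > 0$ and $g < 1$. *)
have ag : (1 - alpha) - (1 - g) != 0.
  have -> : (1 - alpha) - (1 - g) = - (1 - g) * beta.
    by rewrite -queue_geomM; ring.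
  have := queue_geom_itv; case: bal => *; rewrite mulf_neq0 //; lra.
apply: (mulfI ag).
have -> (s X Y : R) : (1 - alpha - (1 - g)) * (X + (s * \sum_(i < n)
    (1 - alpha) ^+ (n.-1 - i) * (1 - g) ^+ i + Y)) =
  (1 - alpha - (1 - g)) * (X + Y) + s * ((1 - alpha - (1 - g)) *
   \sum_(i < n) (1 - alpha) ^+ (n.-1 - i) * (1 - g) ^+ i) by ring.
rewrite -subrXX /=.
rewrite add0n /v.
move: ((1 - alpha) ^+ n) ((1 - g) ^+ n) => A G.
by rewrite queue_geomE; ring.
Qed.

(** Both sides have the same increments in [n]: on the left these are the convolution of
    [queue_arrival_conv]. *)
Lemma queue_arrival_cdf n :
  \sum_(a < n.+1) ber_geom_pmf p alpha a * ber_geom_cdf c g (n - a)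
  = ber_geom_cdf v g n.
Proof.
elim: n => [|n IH].
  by rewrite big_ord_recl big_ord0 /= !ber_geom_cdf0 /= /v; ring.
rewrite ber_geom_cdfS -IH -queue_arrival_conv.
rewrite [X in _ = _ + X](reindex_inj rev_ord_inj) /=.
rewrite big_ord_recr [X in _ = _ + X]big_ord_recr /= !subSS !subnn subn0.
rewrite ber_geom_cdf0 addrA [_ * ber_geom_pmf c g 0]mulrC; congr (_ + _).
rewrite -big_split; apply: eq_bigr => i _ /=.
have ilen : (i <= n)%N by have := ltn_ord i.
have e : (n.+1 - i)%N = (n - i).+1 by rewrite subSn.
by rewrite subSS e subSS subKn// ber_geom_cdfS; ring.
Qed.

(** If $d$ customers leave and $x+1$ remain, then the service was used up, so $X + A = x+1+d$ and $S
    = d$. The left side is the probability of this, the right side the product form of new queue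
    length and departures. *)
Lemma balance_onestepS x d :
  ber_geom_pmf v g (x.+1 + d) * ber_geom_pmf q beta d =
  ber_geom_pmf c g x.+1 * ber_geom_pmf p alpha d.
Proof.
have e := balance_massS; have m := balance_mass0; have h := queue_geomM.
case: d => [|d] /=.
  rewrite addn0.
  have -> : v * g * (1 - g) ^+ x * (1 - q) =
    v * (1 - q) * (g * (1 - g) ^+ x) by ring.
  by rewrite m; ring.
rewrite addnS exprS exprD -h exprMn.
have -> : v * g * ((1 - g) * ((1 - g) ^+ x * (1 - g) ^+ d)) *
   (q * beta * (1 - beta) ^+ d) = (v * (1 - g) * (q * beta)) *
   (g * (1 - g) ^+ x * (1 - g) ^+ d * (1 - beta) ^+ d) by ring.
by rewrite e; ring.
Qed.

(** If $d$ customers leave and none remain, then $X + A = d$ and only $S \ge d$ is known; this is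
    where the tail comes from. *)
Lemma balance_onestep0 d :
  ber_geom_pmf v g d * ber_geom_tail q beta d =
  ber_geom_pmf c g 0 * ber_geom_pmf p alpha d.
Proof.
have e := balance_idle; have h := queue_geomM.
case: d => [|d] /=; first by rewrite /v; ring.
rewrite -h exprMn.
have -> : v * g * (1 - g) ^+ d * (q * (1 - beta) ^+ d) =
   v * g * q * ((1 - g) ^+ d * (1 - beta) ^+ d) by ring.
by rewrite e; ring.
Qed.

(** For $X \sim \pi$ the sum is the probability that $X + A - S \le y$ and $S \le k$. The exact
    remainder makes the induction on [k] close, and it bounds the truncated harmonic equation from
    both sides. *)
Lemma balance_harmonic_rem y k :
  \sum_(s < k.+1) ber_geom_pmf q beta s * ber_geom_cdf v g (y + s) =
  ber_geom_cdf c g y - ber_geom_tail q beta k.+1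
  + (1 - g) ^+ y * (c * p) * (1 - alpha) ^+ k.
Proof.
have e := balance_massS; have m := balance_mass0; have h := queue_geomM.
elim: k => [|k IH].
  rewrite big_ord_recl big_ord0 /= addn0 /ber_geom_cdf /= !expr0.
  have -> : (1 - q) * (1 - v * (1 - g) ^+ y) =
     (1 - q) - (v * (1 - q)) * (1 - g) ^+ y by ring.
  by rewrite m; ring.
rewrite big_ord_recr IH /ber_geom_cdf /= exprD !exprS -h !exprMn.
move: ((1 - g) ^+ y) ((1 - g) ^+ k) ((1 - beta) ^+ k) => Y G B.
apply/eqP; rewrite -subr_eq0; apply/eqP.
transitivity (Y * G * B * (c * p * (1 - (1 - g) * (1 - beta)) -
  v * (1 - g) * (q * beta))); first by ring.
by rewrite e h; ring.
Qed.

Lemma balance_superharmonic y k :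
  ber_geom_cdf c g y - ber_geom_tail q beta k <=
  \sum_(s < k) ber_geom_pmf q beta s *
    \sum_(a < (y + s).+1) ber_geom_pmf p alpha a * ber_geom_cdf c g (y + s - a).
Proof.
under eq_bigr => s _ do rewrite queue_arrival_cdf.
case: (bal) queue_ber_itv queue_geom_itv => hp hq ha hb _ _ hc hg.
case: k => [|k].
  rewrite big_ord0 /= /ber_geom_cdf /=.
  suff : 0 <= c * (1 - g) ^+ y by lra.
  by rewrite mulr_ge0 ?exprn_ge0; lra.
rewrite balance_harmonic_rem lerDl.
have Y0 : 0 <= (1 - g) ^+ y by apply: exprn_ge0; lra.
have A0 : 0 <= (1 - alpha) ^+ k by apply: exprn_ge0; lra.
have cp0 : 0 <= c * p by apply: mulr_ge0; lra.
by apply: mulr_ge0 => //; apply: mulr_ge0.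
Qed.

Lemma balance_subharmonic y k :
  \sum_(s < k) ber_geom_pmf q beta s *
    \sum_(a < (y + s).+1) ber_geom_pmf p alpha a * ber_geom_cdf c g (y + s - a)
  <= ber_geom_cdf c g y.
Proof.
under eq_bigr => s _ do rewrite queue_arrival_cdf.
case: (bal) queue_ber_itv queue_geom_itv => hp hq ha hb _ _ hc hg.
have ab := balance_rate_lt.
case: k => [|k].
  by rewrite big_ord0; apply: ber_geom_cdf_ge0; lra.
rewrite balance_harmonic_rem -addrA gerDl addrC subr_le0 /=.
(* The positive remainder has to be absorbed by the service tail $q(1-\beta)^{k}$. This needs
   $1-\alpha \le 1-\beta$ and $cp \le q$; the latter holds because $cp = v(1-g)q\beta/\alpha$ by
   [balance_massS]. *)
have cpq : c * p <= q.
  have /(congr1 (fun z => z / alpha)) := balance_massS.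
  have -> : c * p * alpha / alpha = c * p by field; lra.
  move=> <-; rewrite ler_pdivrMr; last lra.
  have : v * (1 - g) <= 1.
    have hv : v <= 1.
      rewrite /v; have -> : c + p - c * p = 1 - (1 - c) * (1 - p) by ring.
      suff : 0 <= (1 - c) * (1 - p) by lra.
      by rewrite mulr_ge0; lra.
    by nra.
  move=> h1; have : q * beta <= q * alpha by rewrite ler_pM2l; lra.
  by apply: le_trans; rewrite ler_piMl// mulr_ge0; lra.
have Y1 : (1 - g) ^+ y <= 1 by apply: exprn_ile1; lra.
have Y0 : 0 <= (1 - g) ^+ y by apply: exprn_ge0; lra.
have A0 : 0 <= (1 - alpha) ^+ k by apply: exprn_ge0; lra.
have AB : (1 - alpha) ^+ k <= (1 - beta) ^+ k by rewrite lerXn2r ?nnegrE; lra.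
have cp0 : 0 <= c * p by apply: mulr_ge0; lra.
apply: ler_pM => //; first exact: mulr_ge0.
by apply: (le_trans _ cpq); rewrite ler_piMl.
Qed.

End balance.

(** * Atoms of countably valued maps *)

Section prob.
Context {d : measure_display} {T : measurableType d} {R : realType}.
Variable P : probability T R.

Definition prob (E : set T) : R := fine (P E).

Lemma probK E : measurable E -> P E = (prob E)%:E.
Proof. by move=> mE; rewrite /prob fineK// fin_num_measure. Qed.

Lemma prob_ge0 E : 0 <= prob E.
Proof. by rewrite /prob fine_ge0. Qed.

Lemma probT : prob setT = 1.
Proof. by rewrite /prob probability_setT. Qed.

Lemma prob0 : prob set0 = 0.
Proof. by rewrite /prob measure0. Qed.

Lemma le_prob E F : measurable E -> measurable F -> E `<=` F ->
  prob E <= prob F.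
Proof.
by move=> mE mF EF; rewrite -lee_fin -!probK// le_measure ?inE.
Qed.

Lemma probU E F : measurable E -> measurable F -> E `&` F = set0 ->
  prob (E `|` F) = prob E + prob F.
Proof.
move=> mE mF EF; apply: EFin_inj.
by rewrite EFinD -!probK ?measureU//; exact: measurableU.
Qed.

Definition discretely_measurable (I : Type) (f : T -> I) : Prop :=
  forall B : set I, measurable (f @^-1` B).

Lemma discretely_measurable_fiber (I : countType) (f : T -> I) :
  (forall i, measurable (f @^-1` [set i])) -> discretely_measurable f.
Proof.
move=> mf B; have -> : f @^-1` B = \bigcup_n
    [set w | B (f w) /\ choice.pickle (f w) = n].
  apply/seteqP; split => [w Bw|w [n _ []]//].
  by exists (choice.pickle (f w)).
apply: bigcupT_measurable => n.
have [[i [Bi <-]]|h] := pselect (exists i, B i /\ choice.pickle i = n).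
  rewrite (_ : mkset _ = f @^-1` [set i])//.
  apply/seteqP; split => w /=; first by move=> [_ /(pcan_inj choice.pickleK)].
  by move=> ->.
rewrite (_ : mkset _ = set0)//; apply/seteqP; split => w //= [Bw wn].
by apply: h; exists (f w).
Qed.

Lemma discretely_measurable_comp (I J : Type) (g : I -> J) (f : T -> I) :
  discretely_measurable f -> discretely_measurable (g \o f).
Proof. by move=> mf B; exact: (mf (g @^-1` B)). Qed.

Lemma discretely_measurable_pair (I J : countType) (f : T -> I) (g : T -> J) :
  discretely_measurable f -> discretely_measurable g ->
  discretely_measurable (fun w => (f w, g w)).
Proof.
move=> mf mg; apply: discretely_measurable_fiber => -[i j].
rewrite (_ : _ @^-1` _ = f @^-1` [set i] `&` g @^-1` [set j]).
  exact: measurableI.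
by apply/seteqP; split => w /= [-> ->].
Qed.

(** Slicing [B] by the codes of its elements leaves singletons and empty sets, so countable
    additivity reduces the claim to atoms. With [f] equal to [h] it turns a product formula on atoms
    into independence; with [E] the whole space and [k] equal to 1 it identifies two laws. *)
Lemma prob_atoms (I : countType) (f h : T -> I) (E : set T) (k : R) :
  measurable E -> discretely_measurable f -> discretely_measurable h ->
  0 <= k ->
  (forall i, prob (E `&` f @^-1` [set i]) = k * prob (h @^-1` [set i])) ->
  forall B, prob (E `&` f @^-1` B) = k * prob (h @^-1` B).
Proof.
move=> mE mf mh k0 atoms B; apply: EFin_inj.
pose Bn n := [set i | B i /\ choice.pickle i = n].
have series (F : set T) (u : T -> I) : measurable F -> discretely_measurable u ->
    (prob (F `&` u @^-1` B))%:E = (\sum_(n <oo) (prob (F `&` u @^-1` Bn n))%:E)%E.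
  move=> mF mu.
  have mFn n : measurable (F `&` u @^-1` Bn n) by apply: measurableI.
  rewrite -probK; last by apply: measurableI.
  have -> : F `&` u @^-1` B = \bigcup_n (F `&` u @^-1` Bn n).
    apply/seteqP; split => [w [Fw Bw]|w [n _ [Fw []]]//].
    by exists (choice.pickle (u w)).
  rewrite measure_semi_bigcup//; last exact: bigcupT_measurable.
    by apply: eq_eseriesr => n _; exact: probK.
  apply/trivIsetP => i j _ _ ij; apply/seteqP; split => w //=.
  by move=> [[_ [_ wi]] [_ [_ wj]]]; move: ij; rewrite -wi -wj eqxx.
rewrite EFinM -[h @^-1` B]setTI !series// -nneseriesZl//; last first.
  by move=> n _; rewrite lee_fin prob_ge0.
apply: eq_eseriesr => n _; rewrite setTI -EFinM; congr EFin; rewrite /Bn.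
have [[i [Bi <-]]|no] := pselect (exists i, B i /\ choice.pickle i = n).
  have -> : [set i0 | B i0 /\ choice.pickle i0 = choice.pickle i] = [set i].
    apply/seteqP; split => j /=; first by move=> [_ /(pcan_inj choice.pickleK)].
    by move=> ->.
  exact: atoms.
have -> : [set i | B i /\ choice.pickle i = n] = set0.
  by apply/seteqP; split => j //= Bj; apply: no; exists j.
by rewrite !preimage_set0 setI0 prob0 mulr0.
Qed.

Section nat_valued.
Variables (E : set T) (f : T -> nat).
Hypotheses (mE : measurable E) (mf : discretely_measurable f).

Lemma prob_sum_fibers k :
  prob (E `&` [set w | (f w < k)%N]) =
  \sum_(j < k) prob (E `&` f @^-1` [set (j : nat)]).
Proof.
elim: k => [|k IH].
  rewrite big_ord0 (_ : _ `&` _ = set0) ?prob0//.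
  by apply/seteqP; split => w // [].
rewrite big_ord_recr /= -IH -probU.
- congr prob; apply/seteqP; split => w /=.
    by move=> [Ew]; rewrite ltnS leq_eqVlt => /predU1P[]; [right|left].
  by move=> [[Ew /ltnW]|[Ew ->]].
- by apply: measurableI => //; exact: (mf [set j | (j < k)%N]).
- by apply: measurableI.
- by apply/seteqP; split => w //= [[_ h] [_ e]]; move: h; rewrite e ltnn.
Qed.

Lemma prob_split k : prob E = prob (E `&` [set w | (f w < k)%N]) +
  prob (E `&` [set w | (k <= f w)%N]).
Proof.
rewrite -probU.
- congr prob; apply/seteqP; split => w /=; last by move=> [[]|[]].
  by move=> Ew; have [|] := ltnP (f w) k; [left|right].
- by apply: measurableI => //; exact: (mf [set j | (j < k)%N]).
- by apply: measurableI => //; exact: (mf [set j | (k <= j)%N]).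
- by apply/seteqP; split => w //= [[_ h] [_]]; rewrite leqNgt h.
Qed.

Lemma prob_truncate_cvg (eps : R) : 0 < eps ->
  \forall k \near \oo, prob E < prob (E `&` [set w | (f w < k)%N]) + eps.
Proof.
move=> e0.
have mF k : measurable (E `&` [set w | (f w < k)%N]).
  by apply: measurableI => //; exact: (mf [set j | (j < k)%N]).
have bE : \bigcup_k (E `&` [set w | (f w < k)%N]) = E.
  apply/seteqP; split => [w [k _ []]//|w Ew].
  by exists (f w).+1 => //; split => //=.
have cE : (prob (E `&` [set w | (f w < k)%N]))%:E @[k --> \oo] --> (prob E)%:E.
  rewrite -(probK mE) -[in X in _ --> X]bE.
  have <- : (fun k => P (E `&` [set w | (f w < k)%N])) =
      (fun k => (prob (E `&` [set w | (f w < k)%N]))%:E).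
    by apply/funext => k; exact: probK.
  apply: nondecreasing_cvg_mu => //; first by rewrite bE.
  move=> m k mk; apply/subsetPset => w [Ew /= wm].
  by split => //=; exact: leq_trans wm mk.
move/fine_cvgP : cE => [_] /=; move/cvgr_gt => /(_ (prob E - eps)).
rewrite ltrBlDr ltrDl => /(_ e0); apply: filterS => k /=.
by rewrite ltrBlDr.
Qed.

(** The part of [E] where [f] is below [K] has mass $k$ times one minus the tail at [K], which is at
    most $k$ and tends to $k$. Each inequality is proved up to [e]. *)
Lemma prob_ber_geom_mass (k p a : R) : 0 <= p <= 1 -> 0 < a <= 1 -> 0 <= k ->
  (forall j, prob (E `&` f @^-1` [set j]) = k * ber_geom_pmf p a j) ->
  prob E = k.
Proof.
move=> hp ha k0 atoms.
have fib K : prob (E `&` [set w | (f w < K)%N]) = k * (1 - ber_geom_tail p a K).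
  rewrite prob_sum_fibers -sum_ber_geom_pmf mulr_sumr.
  by apply: eq_bigr => j _; rewrite atoms.
apply/eqP; rewrite eq_le; apply/andP; split; apply/ler_addgt0Pl => e e0.
  have [K _ hK] := prob_truncate_cvg e0.
  have := hK K (leqnn K); rewrite fib => h.
  apply: (le_trans (ltW h)); rewrite addrC lerD2l ler_piMr//.
  by rewrite gerBl ber_geom_tail_ge0//; lra.
(* The denominator is [k + 1] because [k] may be zero; [k] times the tail is then still below
   [e]. *)
have e1 : 0 < e / (k + 1) by rewrite divr_gt0//; lra.
have [K _ hK] := ber_geom_tail_cvg0 hp ha e1.
have := hK K (leqnn K); rewrite ltr_pdivlMr; last lra.
move=> h; have := prob_split K; rewrite fib => ->.
have := prob_ge0 (E `&` [set w | (K <= f w)%N]).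
have : 0 <= ber_geom_tail p a K by apply: ber_geom_tail_ge0; lra.
by nra.
Qed.

Lemma prob_ber_geom_tail (k p a : R) n : 0 <= p <= 1 -> 0 < a <= 1 -> 0 <= k ->
  (forall j, prob (E `&` f @^-1` [set j]) = k * ber_geom_pmf p a j) ->
  prob (E `&` [set w | (n <= f w)%N]) = k * ber_geom_tail p a n.
Proof.
move=> hp ha k0 atoms; have := prob_split n.
rewrite prob_sum_fibers (prob_ber_geom_mass hp ha k0 atoms).
under eq_bigr => j _ do rewrite atoms.
by rewrite -mulr_sumr sum_ber_geom_pmf => e; move: e; lra.
Qed.

End nat_valued.

Lemma prob_bigcap_ge (E : nat -> set T) (k : R) :
  (forall n, measurable (E n)) -> (forall n, E n.+1 `<=` E n) ->
  (forall n, k <= prob (E n)) -> k <= prob (\bigcap_n E n).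
Proof.
move=> mE ni hk.
have mI : measurable (\bigcap_n E n) by apply: bigcapT_measurable.
have : (prob (E n))%:E @[n --> \oo] --> (prob (\bigcap_n E n))%:E.
  rewrite -(probK mI).
  have <- : (fun n => P (E n)) = (fun n => (prob (E n))%:E).
    by apply/funext => n; exact: probK.
  apply: nonincreasing_cvg_mu => //.
    by rewrite -ge0_fin_numE// fin_num_measure.
  by apply/nonincreasing_seqP => n; exact/subsetPset.
move=> /fine_cvgP[_] /= c; rewrite -(cvg_lim _ c)//.
apply: limr_ge; first by apply/cvg_ex; exists (prob (\bigcap_n E n)).
by apply: nearW => n /=.
Qed.

End prob.

(** * Sample paths of a queue *)

Section paths.
Context {R : realType}.
Implicit Types (a s : int -> nat) (n : int) (k x y : nat).

Definition ereal_path a : int -> \bar R := fun n => ((a n)%:R)%:E.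

(** The queue length at time [n] when the queue is empty at time [n - k]; truncated subtraction is
    the maximum with 0. *)
Fixpoint queue_from_empty a s k n : nat :=
  if k is k'.+1
  then (queue_from_empty a s k' (n - 1)%R + a (n - 1)%R - s (n - 1)%R)%N else 0%N.

Fixpoint net_inflow a s k n : int :=
  if k is k'.+1
  then net_inflow a s k' (n - 1)%R + ((a (n - 1)%R)%:Z - (s (n - 1)%R)%:Z) else 0.

Lemma net_input_inflow a s k n :
  net_input (ereal_path a) (ereal_path s) (n - k%:Z) n =
  ((net_inflow a s k n)%:~R)%:E.
Proof.
rewrite /net_input opprB addrC subrK absz_nat.
elim: k n => [|k IH] n; first by rewrite big_nil.
rewrite big_nat_recr//= -(_ : n - 1 = n - k.+1%:Z + k%:Z); last by lia.
have -> : n - k.+1%:Z = n - 1 - k%:Z by lia.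
by rewrite IH /ereal_path -EFinB -EFinD rmorphD rmorphB.
Qed.

Lemma net_inflow_le a s k n : net_inflow a s k n <= (queue_from_empty a s k n)%:Z.
Proof. by elim: k n => [|k IH] n //=; have := IH (n - 1)%R; lia. Qed.

(** [j] counts the slots since the last truncation at 0, or since the start if there was none; from
    there on the queue moves like the unreflected walk. *)
Lemma net_inflow_attained a s k n :
  exists j, net_inflow a s j n = (queue_from_empty a s k n)%:Z.
Proof.
elim: k n => [|k IH] n /=; first by exists 0%N.
have [j hj] := IH (n - 1)%R.
have [le|lt] := leqP (s (n - 1)%R) (queue_from_empty a s k (n - 1)%R + a (n - 1)%R).
  by exists j.+1 => /=; lia.
by exists 0%N => /=; lia.
Qed.

(** The unreflected walk lies below the reflected one, and each reflected value is attained by an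
    unreflected walk with another starting time, so the two suprema agree. *)
Lemma queue_lengthE a s n :
  queue_length (ereal_path a) (ereal_path s) n =
  ereal_sup (range (fun k => ((queue_from_empty a s k n)%:R)%:E)).
Proof.
apply/eqP; rewrite eq_le; apply/andP; split.
  apply: ge_ereal_sup => _ [m /= mn <-].
  have -> : m = n - (absz (n - m)%R)%:Z by lia.
  rewrite net_input_inflow; apply: le_ereal_sup_tmp.
  eexists; first by exists (absz (n - m)%R).
  by rewrite lee_fin -[leRHS]/((Posz _)%:~R) ler_int net_inflow_le.
apply: ge_ereal_sup => _ [k _ <-].
have [j hj] := net_inflow_attained a s k n.
apply: ereal_sup_ubound; exists (n - j%:Z) => /=; first by lia.
by rewrite net_input_inflow hj.
Qed.

(** This is the event $X_n \le y$ stated inside [nat], meaningful before the queue length is known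
    to be finite. *)
Definition queue_bounded a s n y := forall k, (queue_from_empty a s k n <= y)%N.

Lemma queue_length_le a s n y :
  (queue_length (ereal_path a) (ereal_path s) n <= (y%:R)%:E)%E <->
  queue_bounded a s n y.
Proof.
rewrite queue_lengthE; split=> [h k|h].
  rewrite -(@ler_nat R) -lee_fin; apply: le_trans h.
  by apply: ereal_sup_ubound; exists k.
by apply: ge_ereal_sup => _ [k _ <-]; rewrite lee_fin ler_nat.
Qed.

Lemma queue_length_natP a s n x :
  queue_length (ereal_path a) (ereal_path s) n = (x%:R)%:E <->
  forall y, queue_bounded a s n y <-> (x <= y)%N.
Proof.
split=> [e y|h].
  by rewrite -queue_length_le e lee_fin ler_nat.
apply/eqP; rewrite eq_le; apply/andP; split; first exact/queue_length_le/h.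
have [k hk] : exists k, (x <= queue_from_empty a s k n)%N.
  case: x h => [|x] h; first by exists 0%N.
  apply: contrapT => /forallNP no.
  have /h : queue_bounded a s n x by move=> k; rewrite leqNgt; exact/negP/no.
  by rewrite ltnn.
rewrite queue_lengthE; apply: le_ereal_sup_tmp.
by eexists; [by exists k | rewrite lee_fin ler_nat].
Qed.

Lemma queue_length_dichotomy a s n :
  queue_length (ereal_path a) (ereal_path s) n = +oo%E \/
  exists x, queue_length (ereal_path a) (ereal_path s) n = (x%:R)%:E.
Proof.
have [[y hy]|no] := pselect (exists y, queue_bounded a s n y).
  right; have ex : exists y, `[< queue_bounded a s n y >] by exists y; exact/asboolP.
  exists (ex_minn ex); apply/queue_length_natP => z.
  case: ex_minnP => m /asboolP hm least; split=> [/asboolP /least//|mz k].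
  exact: leq_trans (hm k) mz.
left; case e : queue_length => [r| |] //.
  exfalso; apply: no; exists (Num.truncn r).+1; apply/queue_length_le.
  by rewrite e lee_fin ltW// truncnS_gt.
have : (0 <= queue_length (ereal_path a) (ereal_path s) n)%E.
  by rewrite queue_lengthE; apply: ereal_sup_ubound; exists 0%N.
by rewrite e.
Qed.

Lemma queue_bounded_step a s n y : queue_bounded a s n y <->
  forall k, (queue_from_empty a s k (n - 1)%R + a (n - 1)%R <= y + s (n - 1)%R)%N.
Proof.
split=> [h k|h [|k]//=]; first by have := h k.+1 => /=; lia.
by have := h k; lia.
Qed.

(** This is the killing: an arrival larger than $y + S$ rules out the bound $y$. Hence, for a given
    service, finitely many arrival values have to be summed. *)
Lemma queue_bounded_arrival a s n y : queue_bounded a s n y ->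
  (a (n - 1)%R < (y + s (n - 1)%R).+1)%N.
Proof. by move=> /queue_bounded_step /(_ 0%N) /=. Qed.

Lemma queue_bounded_past a s n y : queue_bounded a s n y ->
  queue_bounded a s (n - 1) (y + s (n - 1)%R - a (n - 1)%R).
Proof. by move=> /queue_bounded_step h k; have := h k; lia. Qed.

Lemma queue_from_empty_past a s k n y : (a (n - 1)%R < (y + s (n - 1)%R).+1)%N ->
  (queue_from_empty a s k (n - 1) <= y + s (n - 1)%R - a (n - 1)%R)%N ->
  (queue_from_empty a s k.+1 n <= y)%N.
Proof. by move=> /=; lia. Qed.

Lemma queue_from_empty_mono a s k n :
  (queue_from_empty a s k n <= queue_from_empty a s k.+1 n)%N.
Proof. by elim: k n => [|k IH] n //=; have := IH (n - 1) => /=; lia. Qed.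

(** Lindley's recursion, together with finiteness backwards in time: the bound $x$ at time $n$ gives
    the bound $x + S_{n-1}$ at time $n-1$. *)
Lemma queue_length_step a s n x :
  queue_length (ereal_path a) (ereal_path s) n = (x%:R)%:E <->
  exists2 x0, queue_length (ereal_path a) (ereal_path s) (n - 1)%R = (x0%:R)%:E &
    x = (x0 + a (n - 1)%R - s (n - 1)%R)%N.
Proof.
have lindley x0 :
    queue_length (ereal_path a) (ereal_path s) (n - 1)%R = (x0%:R)%:E ->
    queue_length (ereal_path a) (ereal_path s) n =
      ((x0 + a (n - 1)%R - s (n - 1)%R)%N%:R)%:E.
  move=> /queue_length_natP h; apply/queue_length_natP => y.
  rewrite queue_bounded_step; split => [hy|hy k].
    have : queue_bounded a s (n - 1)%R (y + s (n - 1)%R - a (n - 1)%R).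
      by move=> k; have := hy k; lia.
    by move/h; have := hy 0%N => /=; lia.
  have : queue_bounded a s (n - 1)%R x0 by exact/h.
  by move=> /(_ k); lia.
split=> [e|[x0 /lindley -> -> //]].
have [inf|[x0 h]] := queue_length_dichotomy a s (n - 1)%R.
  have : queue_bounded a s (n - 1)%R (x + s (n - 1)%R).
    move=> k; have := (queue_length_natP a s n x).1 e x.
    rewrite leqnn => -[_ /(_ isT)] /queue_bounded_step /(_ k); lia.
  by move/queue_length_le; rewrite inf leye_eq.
exists x0 => //; move: e; rewrite (lindley _ h) => -[].
by move/eqP; rewrite eqr_nat => /eqP.
Qed.

Lemma departures_nat a s n x :
  queue_length (ereal_path a) (ereal_path s) n = (x%:R)%:E ->
  departures (ereal_path a) (ereal_path s) n =
  ((minn (x + a n) (s n))%:R)%:E.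
Proof.
move=> e; rewrite /departures e /ereal_path -EFinD -natrD -EFin_min.
by rewrite natr_min.
Qed.

(** With an infinite queue the whole service is used, so departures are finite in any case. The
    tandem can thus be built in [nat] on every sample path. *)
Lemma departures_natural a s n :
  exists k, departures (ereal_path a) (ereal_path s) n = (k%:R)%:E.
Proof.
have [e|[x /departures_nat ->]] := queue_length_dichotomy a s n; last first.
  by eexists.
by exists (s n); rewrite /departures e addye// minye.
Qed.

End paths.

(** * The stationary queue length *)

Section fibers.
Context {d : measure_display} {T : measurableType d} {R : realType}.
Variables (P : probability T R) (F : set T) (f g : T -> nat) (m : nat -> nat).
Hypotheses (mF : measurable F) (mf : discretely_measurable f).
Hypothesis mg : discretely_measurable g.

Let fiber_pair i j :
  F `&` (fun w => (f w, g w)) @^-1` [set (i, j)] =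
  F `&` g @^-1` [set j] `&` f @^-1` [set i].
Proof. by apply/seteqP; split => w /=; [case=> ? [-> ->]|case=> -[? ->] ->]. Qed.

Let mFg j : measurable (F `&` g @^-1` [set j]).
Proof. exact: measurableI. Qed.

(** Here and in [prob_le_fibers], [f] will be the arrival and [g] the service of the last slot, and
    [m j] will be [(y + j).+1], so that exactly the arrivals compatible with level [y] are kept. *)
Lemma prob_ge_fibers k :
  \sum_(j < k) \sum_(i < m j)
     prob P (F `&` (fun w => (f w, g w)) @^-1` [set ((i : nat), (j : nat))])
  <= prob P F.
Proof.
rewrite (prob_split P mF mg k) prob_sum_fibers//.
rewrite -[leLHS]addr0 lerD ?prob_ge0//; apply: ler_sum => j _.
rewrite (prob_split P (mFg j) mf (m j)) prob_sum_fibers//.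
rewrite -[leLHS]addr0 lerD ?prob_ge0//; apply: ler_sum => i _.
by rewrite fiber_pair.
Qed.

Lemma prob_le_fibers k : (forall w, F w -> (f w < m (g w))%N) ->
  prob P F <= \sum_(j < k) \sum_(i < m j)
     prob P (F `&` (fun w => (f w, g w)) @^-1` [set ((i : nat), (j : nat))])
  + prob P (F `&` [set w | (k <= g w)%N]).
Proof.
move=> Fm; rewrite (prob_split P mF mg k) prob_sum_fibers// lerD2r.
apply: ler_sum => j _.
rewrite (prob_split P (mFg j) mf (m j)) prob_sum_fibers// [X in _ + X](_ : _ = 0).
  by rewrite addr0; apply: ler_sum => i _; rewrite fiber_pair.
rewrite (_ : _ `&` _ = set0) ?prob0//; apply/seteqP; split => w //=.
by move=> [[Fw gw]]; rewrite leqNgt -gw Fm.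
Qed.

End fibers.

(** The list runs backwards in time from [n - 1], so that induction on it peels off the most recent
    slot. *)
Fixpoint past_window (T I : Type) (Y : int -> T -> I) (n : int) (v : seq I) : set T :=
  if v is x :: v' then Y (n - 1) @^-1` [set x] `&` past_window Y (n - 1) v'
  else setT.

Lemma measurable_past_window d (T : measurableType d) (I : Type)
    (Y : int -> T -> I) n v :
  (forall k, discretely_measurable (Y k)) -> measurable (past_window Y n v).
Proof.
move=> mY; elim: v n => [|x v IH] n //=.
by apply: measurableI => //; exact: mY.
Qed.

Definition slot_pair (T : Type) (a s : int -> T -> nat) n w := (a n w, s n w).

Lemma past_window_pair (T : Type) (a s : int -> T -> nat) n v :
  past_window (slot_pair a s) n v =
  past_window a n (unzip1 v) `&` past_window s n (unzip2 v).
Proof.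
elim: v n => [|[i j] v IH] n /=; first by rewrite setIT.
rewrite IH setIACA; congr (_ `&` _); apply/seteqP.
by split => w; [case=> <- <-|case=> /= <- <-].
Qed.

Definition queue_at_most (T : Type) (a s : int -> T -> nat) n y : set T :=
  [set w | queue_bounded (a ^~ w) (s ^~ w) n y].

Section single_queue.
Context {d : measure_display} {T : measurableType d} {R : realType}.
Context (P : probability T R) (p q alpha beta : R).
Hypothesis bal : stable_balance p q alpha beta.
Context (a s : int -> T -> nat).
Hypotheses (ma : forall n, discretely_measurable (a n)).
Hypotheses (ms : forall n, discretely_measurable (s n)).
Local Notation pr := (prob P).
Local Notation pA := (ber_geom_pmf p alpha).
Local Notation pS := (ber_geom_pmf q beta).
Local Notation c := (queue_ber alpha beta).
Local Notation g := (queue_geom alpha beta).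

Local Notation Z := (slot_pair a s).
Local Notation L := (queue_at_most a s).
Local Notation U k n := (fun w => queue_from_empty (a ^~ w) (s ^~ w) k n).

(* Conditionally on [E], the pairs (A_k, S_k), k < n, are i.i.d. *)
Definition iid_past (E : set T) (n : int) : Prop :=
  measurable E /\ forall v : seq (nat * nat),
    pr (E `&` past_window Z n v) = pr E * \prod_(u <- v) (pA u.1 * pS u.2).

Let mZ n : discretely_measurable (Z n).
Proof. exact: discretely_measurable_pair. Qed.

Lemma iid_past_prob E n i j : iid_past E n ->
  pr (E `&` Z (n - 1) @^-1` [set (i, j)]) = pr E * (pA i * pS j).
Proof.
by move=> [_ /(_ [:: (i, j)])] /=; rewrite setIT big_cons big_nil mulr1.
Qed.

Lemma iid_past_step E n i j : iid_past E n ->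
  iid_past (E `&` Z (n - 1) @^-1` [set (i, j)]) (n - 1).
Proof.
move=> iE; have [mE hE] := iE; split=> [|v].
  by apply: measurableI => //; exact: mZ.
by have := hE ((i, j) :: v); rewrite /= setIA big_cons iid_past_prob// mulrA.
Qed.

Lemma measurable_queue_from_empty k n : discretely_measurable (U k n).
Proof.
elim: k n => [|k IH] n.
  by apply: (@discretely_measurable_comp _ _ _ _ (fun=> 0%N) (a n)).
apply: (@discretely_measurable_comp _ _ _ _
  (fun u : nat * (nat * nat) => (u.1 + u.2.1 - u.2.2)%N)
  (fun w => (U k (n - 1) w, Z (n - 1) w))).
by apply: discretely_measurable_pair => //; exact: mZ.
Qed.

Let bounded_bigcap n y : L n y = \bigcap_k U k n @^-1` [set u | (u <= y)%N].
Proof. by apply/seteqP; split => w h; [move=> k _; exact: h|move=> k; exact: h]. Qed.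

Lemma measurable_queue_at_most n y : measurable (L n y).
Proof.
rewrite bounded_bigcap; apply: bigcapT_measurable => k.
exact: measurable_queue_from_empty.
Qed.

(** An empty queue is stochastically below $\pi$, and the harmonic equation carries this through one
    slot. The statement ranges over all [E] because the induction adds the values of the last slot
    to the conditioning. *)
Lemma prob_queue_from_empty_ge k E n y : iid_past E n ->
  pr E * ber_geom_cdf c g y <= pr (E `&` U k n @^-1` [set u | (u <= y)%N]).
Proof.
case: (bal) (queue_ber_itv bal) (queue_geom_itv bal) => hp hq ha hb _ _ hc hg.
elim: k E n y => [|k IH] E n y iE; have [mE _] := iE.
  rewrite (_ : _ `&` _ = E); last by apply/seteqP; split => [w []|w Ew].
  rewrite ler_piMr ?prob_ge0// /ber_geom_cdf gerBl.
  by apply: ber_geom_tail_ge0; lra.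
set F := E `&` _.
have mF : measurable F by apply: measurableI => //; exact: measurable_queue_from_empty.
(* Only the services below [K] are summed; the lost tail vanishes as [K] grows. *)
suff h K : pr E * (ber_geom_cdf c g y - ber_geom_tail q beta K) <= pr F.
  apply/ler_addgt0Pl => e e0.
  have [K _ hK] := @ber_geom_tail_cvg0 R q beta e ltac:(lra) ltac:(lra) e0.
  have := h K; have := hK K (leqnn K).
  have : pr E <= 1 by rewrite -(probT P); exact: le_prob.
  have := prob_ge0 P E.
  have : 0 <= ber_geom_tail q beta K by apply: ber_geom_tail_ge0; lra.
  move=> t0 E0 E1 te; rewrite mulrBr lerBlDr => /le_trans; apply.
  by rewrite addrC lerD2r; apply: le_trans (ltW te); rewrite ler_piMl.
apply: le_trans (prob_ge_fibers P (fun j => (y + j).+1) mF (ma (n - 1)) (ms (n - 1)) K).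
apply: (@le_trans _ _ (pr E * \sum_(j < K) pS j *
  \sum_(i < (y + j).+1) pA i * ber_geom_cdf c g (y + j - i))).
  by rewrite ler_wpM2l ?prob_ge0//; exact: balance_superharmonic.
rewrite mulr_sumr; apply: ler_sum => j _; rewrite mulrA mulr_sumr.
apply: ler_sum => i _.
apply: (@le_trans _ _ (pr (E `&` Z (n - 1) @^-1` [set (i : nat, j : nat)]) *
   ber_geom_cdf c g (y + j - i))).
  by rewrite iid_past_prob// le_eqVlt; apply/orP; left; apply/eqP; ring.
apply: (le_trans (IH _ _ _ (iid_past_step i j iE))).
apply: le_prob.
- apply: measurableI; last exact: measurable_queue_from_empty.
  by apply: measurableI => //; exact: mZ.
- by apply: measurableI => //; exact: mZ.
- move=> w [[Ew [ai sj]] Uw]; split; last by rewrite /= -ai -sj.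
  split => //; apply: queue_from_empty_past; rewrite ai sj//.
Qed.

Lemma prob_queue_at_most_ge E n y : iid_past E n ->
  pr E * ber_geom_cdf c g y <= pr (E `&` L n y).
Proof.
move=> iE; have [mE _] := iE; rewrite bounded_bigcap.
have -> : E `&` \bigcap_k U k n @^-1` [set u | (u <= y)%N] =
          \bigcap_k (E `&` U k n @^-1` [set u | (u <= y)%N]).
  by apply/seteqP; split => [w [Ew Uw] k _|w h]; [split => //; exact: Uw|
    split; [exact: (h 0%N _).1|move=> k _; exact: (h k _).2]].
apply: prob_bigcap_ge => k.
- by apply: measurableI => //; exact: measurable_queue_from_empty.
- move=> w [Ew /= Uw]; split => //=; apply: leq_trans Uw; exact: queue_from_empty_mono.
- exact: prob_queue_from_empty_ge.
Qed.

Lemma prob_service_tail E n k : iid_past E n ->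
  pr (E `&` [set w | (k <= s (n - 1) w)%N]) = pr E * ber_geom_tail q beta k.
Proof.
case: (bal) => hp hq ha hb _ _ iE; have [mE _] := iE.
apply: (@prob_ber_geom_tail _ _ _ P E (s (n - 1)) mE (ms _));
  rewrite ?prob_ge0//; try lra.
move=> j; have mEj : measurable (E `&` s (n - 1) @^-1` [set j]).
  by apply: measurableI => //; exact: ms.
apply: (@prob_ber_geom_mass _ _ _ P _ (a (n - 1)) mEj (ma _) _ p alpha);
  rewrite ?mulr_ge0 ?prob_ge0 ?ber_geom_pmf_ge0//; try lra.
move=> i; rewrite -[RHS]mulrA [X in _ * X]mulrC -(iid_past_prob i j iE).
rewrite -setIA; congr (pr (_ `&` _)); apply/seteqP.
split => w; first by move=> [/= <- <-].
by move=> [<- <-].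
Qed.

(* [B] bounds the excess of the distribution function of the queue length over
   [ber_geom_cdf c g]; one more time slot shrinks it, because with positive
   probability the queue would have had to be negative to stay below [y]. *)
Lemma prob_queue_at_most_contract (B : R) : 0 <= B ->
  (forall E n y, iid_past E n ->
     pr (E `&` L n y) <= pr E * (ber_geom_cdf c g y + B)) ->
  forall E n y, iid_past E n ->
    pr (E `&` L n y) <= pr E * (ber_geom_cdf c g y +
      B * (1 - (1 - q) * ber_geom_tail p alpha y.+1)).
Proof.
case: (bal) (queue_ber_itv bal) (queue_geom_itv bal) => hp hq ha hb _ _ hc hg.
move=> B0 hB E n y iE; have [mE _] := iE.
set r := (1 - q) * _.
have mF : measurable (E `&` L n y).
  by apply: measurableI => //; exact: measurable_queue_at_most.
have Emass : pr E <= 1 by rewrite -(probT P); exact: le_prob.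
suff h K : pr (E `&` L n y) <=
    pr E * (ber_geom_cdf c g y + B * (1 - r) + ber_geom_tail q beta K.+1).
  apply/ler_addgt0Pl => e e0.
  have [K _ hK] := @ber_geom_tail_cvg0 R q beta e ltac:(lra) ltac:(lra) e0.
  have := h K; have := hK K.+1 (leqnSn K).
  have := prob_ge0 P E.
  have : 0 <= ber_geom_tail q beta K.+1 by apply: ber_geom_tail_ge0; lra.
  move=> t0 E0 te; rewrite mulrDr => /le_trans; apply; rewrite addrC lerD2r.
  by apply: le_trans (ltW te); rewrite ler_piMl.
have Lm w : (E `&` L n y) w -> (a (n - 1) w < (y + s (n - 1) w).+1)%N.
  by move=> [_ /queue_bounded_arrival].
apply: (le_trans (prob_le_fibers P mF (ma (n - 1)) (ms (n - 1)) K.+1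
  (m := fun j => (y + j).+1) Lm)).
have tailF : pr (E `&` L n y `&` [set w | (K.+1 <= s (n - 1) w)%N]) <=
    pr E * ber_geom_tail q beta K.+1.
  rewrite -(prob_service_tail K.+1 iE); apply: le_prob => [||w [[]]//].
    by apply: measurableI => //; exact: (ms (n - 1) [set j | (K.+1 <= j)%N]).
  by apply: measurableI => //; exact: (ms (n - 1) [set j | (K.+1 <= j)%N]).
rewrite mulrDr lerD// {tailF}.
apply: (@le_trans _ _ (pr E * \sum_(j < K.+1) pS j *
  \sum_(i < (y + j).+1) pA i * (ber_geom_cdf c g (y + j - i) + B))).
  rewrite mulr_sumr; apply: ler_sum => j _; rewrite mulrA mulr_sumr.
  apply: ler_sum => i _.
  apply: (@le_trans _ _ (pr (E `&` Z (n - 1) @^-1` [set (i : nat, j : nat)]) *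
     (ber_geom_cdf c g (y + j - i) + B))); last first.
    by rewrite iid_past_prob// le_eqVlt; apply/orP; left; apply/eqP; ring.
  apply: le_trans (hB _ _ _ (iid_past_step i j iE)).
  apply: le_prob.
  - by apply: measurableI => //; exact: mZ.
  - apply: measurableI; last exact: measurable_queue_at_most.
    by apply: measurableI => //; exact: mZ.
  - move=> w [[Ew Lw] Zw]; split; first by [].
    by case: Zw => <- <-; exact: queue_bounded_past.
rewrite ler_wpM2l ?prob_ge0//.
have mass (j : nat) : \sum_(i < (y + j).+1) pA i <= 1.
  rewrite sum_ber_geom_pmf gerBl; apply: ber_geom_tail_ge0; lra.
have -> : \sum_(j < K.+1) pS j *
    (\sum_(i < (y + j).+1) pA i * (ber_geom_cdf c g (y + j - i) + B)) =
  \sum_(j < K.+1) pS j *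
    (\sum_(i < (y + j).+1) pA i * ber_geom_cdf c g (y + j - i)) +
  B * \sum_(j < K.+1) pS j * (\sum_(i < (y + j).+1) pA i).
  rewrite mulr_sumr -big_split /=; apply: eq_bigr => j _.
  rewrite [B * _]mulrCA -mulrDr; congr (_ * _); rewrite mulr_sumr -big_split.
  by apply: eq_bigr => i _ /=; ring.
apply: lerD; first exact: balance_subharmonic.
rewrite ler_wpM2l// big_ord_recl addn0 sum_ber_geom_pmf.
(* The loss is taken only from the term with zero service, of mass $1-q$. In the other terms, of
   total mass at most $q$, the survival probability is bounded by 1. *)
apply: (@le_trans _ _ ((1 - q) * (1 - ber_geom_tail p alpha y.+1) + q)).
  rewrite lerD2l; apply: (@le_trans _ _ (\sum_(i < K) pS (bump 0 i))).
    apply: ler_sum => i _; rewrite ler_piMr ?ber_geom_pmf_ge0//; lra.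
  have := sum_ber_geom_pmf q beta K.+1; rewrite big_ord_recl /=.
  have : 0 <= ber_geom_tail q beta K.+1 by apply: ber_geom_tail_ge0; lra.
  by rewrite /=; lra.
by rewrite /r; lra.
Qed.

Lemma prob_queue_at_most E n y : iid_past E n ->
  pr (E `&` L n y) = pr E * ber_geom_cdf c g y.
Proof.
case: (bal) (queue_ber_itv bal) (queue_geom_itv bal) => hp hq ha hb _ _ hc hg.
move=> iE; apply/eqP; rewrite eq_le prob_queue_at_most_ge// andbT.
have mass E' n' : iid_past E' n' -> pr E' <= 1.
  by move=> [mE' _]; rewrite -(probT P); exact: le_prob.
apply/ler_addgt0Pl => e2 e20.
pose e := e2 / 2; have e0 : 0 < e by rewrite divr_gt0.
have [Y _ hY] := @ber_geom_tail_cvg0 R c g e ltac:(lra) ltac:(lra) e0.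
have {}hY y' : (Y <= y')%N -> ber_geom_tail c g y'.+1 <= e.
  by move=> Yy; apply/ltW/hY; exact: leqW.
(* The killing probability decreases in the level, so its value at [Y] gives a contraction factor
   valid for all levels up to [Y]. *)
pose r := 1 - (1 - q) * ber_geom_tail p alpha Y.+1.
have tailY : 0 < ber_geom_tail p alpha Y.+1 <= 1.
  rewrite /= mulr_gt0 ?exprn_gt0; try lra.
  rewrite -[leRHS]mulr1 ler_pM ?exprn_ge0 ?exprn_ile1//; lra.
have r01 : 0 <= r < 1.
  by rewrite /r; apply/andP; split; nra.
(* Above [Y] the excess is at most [e], since the distribution function of $\pi$ is already within
   [e] of 1. Up to [Y] the contraction applies, and $(r^k + e)r \le r^{k+1} + e$. *)
have iter k E' n' y' : iid_past E' n' ->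
    pr (E' `&` L n' y') <= pr E' * (ber_geom_cdf c g y' + (r ^+ k + e)).
  elim: k E' n' y' => [|k IH] E' n' y' iE'; have [mE' _] := iE';
      have pE' := prob_ge0 P E'.
    have : 0 <= ber_geom_cdf c g y' by apply: ber_geom_cdf_ge0; lra.
    have : pr (E' `&` L n' y') <= pr E'.
      by apply: le_prob => //; apply: measurableI => //; exact: measurable_queue_at_most.
    rewrite expr0 => /le_trans h G0; apply: h.
    by rewrite ler_peMr//; lra.
  have rk : 0 <= r ^+ k by apply: exprn_ge0; lra.
  have rk1 : 0 <= r ^+ k.+1 by apply: exprn_ge0; lra.
  have [y'Y|Yy'] := leqP y' Y; last first.
    have := hY y' (ltnW Yy').
    have : pr (E' `&` L n' y') <= pr E'.
      by apply: le_prob => //; apply: measurableI => //; exact: measurable_queue_at_most.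
    move=> /le_trans h t; apply: h; rewrite /ber_geom_cdf ler_peMr//; lra.
  apply: (le_trans (prob_queue_at_most_contract _ IH y' iE')); first lra.
  rewrite ler_wpM2l// lerD2l.
  have tail_le : ber_geom_tail p alpha Y.+1 <= ber_geom_tail p alpha y'.+1.
    by rewrite /= ler_wpM2l ?ler_wiXn2l//; lra.
  have : 1 - (1 - q) * ber_geom_tail p alpha y'.+1 <= r.
    by rewrite /r lerB// ler_wpM2l//; lra.
  rewrite exprSr => h.
  apply: (@le_trans _ _ ((r ^+ k + e) * r)); first by rewrite ler_wpM2l//; lra.
  by rewrite mulrDl lerD2l ler_piMr//; lra.
have := @cvg_expr R r; rewrite ger0_norm; last lra.
move=> /(_ ltac:(lra)) /cvgr_lt => /(_ e e0) /= [k _ /(_ k (leqnn k)) rk].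
have rk0 : 0 <= r ^+ k by apply: exprn_ge0; lra.
have := iter k E n y iE; have := mass E n iE; have := prob_ge0 P E.
have -> : e2 = e + e by rewrite /e; lra.
move=> E0 E1 /le_trans; apply; rewrite mulrDr addrC lerD2r.
rewrite (le_trans (ler_piMl _ E1))//; first lra.
by rewrite lerD2r ltW.
Qed.

End single_queue.

(** * Joint law of the past departures and the queue length *)

Section departure_paths.
Context {R : realType} (a s : int -> nat) (n : int).
Local Notation queue m := (queue_length (@ereal_path R a) (ereal_path s) m).
Local Notation departed m := (departures (@ereal_path R a) (ereal_path s) m).

Lemma queue_bounded0 : queue_bounded a s n 0 <-> queue n = (0%:R)%:E.
Proof.
split=> [h|/queue_length_natP ->//]; apply/queue_length_natP => y.
by split=> // _ k; apply: leq_trans (h k) _.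
Qed.

Lemma queue_boundedS x : queue_bounded a s n x.+1 <->
  queue_bounded a s n x \/ queue n = (x.+1%:R)%:E.
Proof.
split=> [h|[h k|/queue_length_natP -> //]]; last exact: leqW.
have [hx|hx] := pselect (queue_bounded a s n x); first by left.
right; apply/queue_length_natP => y; split=> [hy|xy k].
  by rewrite ltnNge; apply/negP => yx; apply: hx => k; exact: leq_trans (hy k) yx.
exact: leq_trans (h k) xy.
Qed.

Lemma queue_departure x j :
  queue n = (x%:R)%:E /\ departed (n - 1) = (j%:R)%:E <->
  exists x0, [/\ queue (n - 1) = (x0%:R)%:E,
    x = (x0 + a (n - 1)%R - s (n - 1)%R)%N &
    j = minn (x0 + a (n - 1)%R) (s (n - 1)%R)].
Proof.
split=> [[/queue_length_step[x0 q0 ->]]|[x0 [q0 ex ->]]]; last first.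
  split; last exact: departures_nat.
  by apply/queue_length_step; exists x0.
rewrite (departures_nat q0) => -[/eqP]; rewrite eqr_nat => /eqP <-.
by exists x0.
Qed.

(** A queue left nonempty has used its service completely, which determines both the service and the
    previous queue length. *)
Lemma queue_departureS x j i :
  [/\ queue n = (x.+1%:R)%:E, departed (n - 1) = (j%:R)%:E & a (n - 1) = i]
  <-> [/\ (i < (x.+1 + j).+1)%N, a (n - 1) = i, s (n - 1) = j &
       queue (n - 1) = ((x.+1 + j - i)%N%:R)%:E].
Proof.
split=> [[q0 d0 ai]|[lei ai sj q0]].
  have /queue_departure[x0 [-> ]] := conj q0 d0; rewrite ai => e1 e2.
  by split; try congr (_%:R%:E); lia.
have /queue_departure[//] : exists x0, [/\ queue (n - 1) = (x0%:R)%:E,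
    x.+1 = (x0 + a (n - 1)%R - s (n - 1)%R)%N &
    j = minn (x0 + a (n - 1)%R) (s (n - 1)%R)].
by exists (x.+1 + j - i)%N; split => //; lia.
Qed.

(** A queue left empty has served everybody present, so the previous queue length is $j - i$ and the
    service is determined only up to $S \ge j$. *)
Lemma queue_departure0 j i :
  [/\ queue n = (0%:R)%:E, departed (n - 1) = (j%:R)%:E & a (n - 1) = i]
  <-> [/\ (i < j.+1)%N, a (n - 1) = i, (j <= s (n - 1)%R)%N &
       queue (n - 1) = ((j - i)%N%:R)%:E].
Proof.
split=> [[q0 d0 ai]|[lei ai sj q0]].
  have /queue_departure[x0 [-> ]] := conj q0 d0; rewrite ai => e1 e2.
  by split; try congr (_%:R%:E); lia.
have /queue_departure[//] : exists x0, [/\ queue (n - 1) = (x0%:R)%:E,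
    0%N = (x0 + a (n - 1)%R - s (n - 1)%R)%N &
    j = minn (x0 + a (n - 1)%R) (s (n - 1)%R)].
by exists (j - i)%N; split => //; lia.
Qed.

End departure_paths.

Section burke.
Context {d : measure_display} {T : measurableType d} {R : realType}.
Context (P : probability T R) (p q alpha beta : R).
Hypothesis bal : stable_balance p q alpha beta.
Context (a s dep : int -> T -> nat).
Hypotheses (ma : forall n, discretely_measurable (a n)).
Hypotheses (ms : forall n, discretely_measurable (s n)).
Hypotheses (mdep : forall n, discretely_measurable (dep n)).
Hypothesis depE : forall n w,
  departures (ereal_path (a ^~ w)) (ereal_path (s ^~ w)) n =
  ((dep n w)%:R)%:E :> \bar R.
Local Notation pr := (prob P).
Local Notation pA := (ber_geom_pmf p alpha).
Local Notation pS := (ber_geom_pmf q beta).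
Local Notation c := (queue_ber alpha beta).
Local Notation g := (queue_geom alpha beta).
Local Notation iid_past := (iid_past P p q alpha beta a s).

Definition queue_event n x := [set w |
  queue_length (ereal_path (a ^~ w)) (ereal_path (s ^~ w)) n =
  (x%:R)%:E :> \bar R].

Local Notation L := (queue_at_most a s).

Let mL n y : measurable (L n y).
Proof. exact: measurable_queue_at_most. Qed.

Let queue_event0 n : queue_event n 0 = L n 0.
Proof. by apply/seteqP; split => w; move/(@queue_bounded0 R). Qed.

Let queue_eventS n x : queue_event n x.+1 = L n x.+1 `\` L n x.
Proof.
apply/seteqP; split => w.
  move=> h; split; first by apply/(@queue_boundedS R); right.
  by move: h => /queue_length_natP h /h; rewrite ltnn.
by move=> [/(@queue_boundedS R)[]].
Qed.

Lemma measurable_queue_event n x : measurable (queue_event n x).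
Proof.
case: x => [|x]; first by rewrite queue_event0.
by rewrite queue_eventS; exact: measurableD.
Qed.

Lemma prob_queue_event E n x : iid_past E n ->
  pr (E `&` queue_event n x) = pr E * ber_geom_pmf c g x.
Proof.
move=> iE; have [mE _] := iE.
case: x => [|x].
  by rewrite queue_event0 (prob_queue_at_most bal ma ms 0 iE) ber_geom_cdf0.
have := prob_queue_at_most bal ma ms x.+1 iE.
rewrite (_ : E `&` _ = (E `&` queue_event n x.+1) `|` (E `&` L n x)); last first.
  rewrite -setIUr; congr (_ `&` _); apply/seteqP; split => w.
    by move=> /(@queue_boundedS R)[]; [right|left].
  by move=> h; apply/(@queue_boundedS R); case: h; [right|left].
rewrite probU; first last.
- by rewrite queue_eventS; apply/seteqP; split => w // [[_ [_ +]] [_ ?]].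
- exact: measurableI.
- by apply: measurableI => //; exact: measurable_queue_event.
rewrite (prob_queue_at_most bal ma ms x iE) ber_geom_cdfS.
rewrite (mulrDr (pr E) (ber_geom_cdf c g x)).
by move=> e; apply: (addIr (pr E * ber_geom_cdf c g x)); rewrite e addrC.
Qed.

(** Burke's property, by induction on the window. The arrival and service of the last slot join [E],
    and the hypothesis at time [n - 1] gives a product. Summing over the arrival produces the law
    Ber(v)Geom(g) of $X + A$, and the one-slot identities factor the result. *)
Lemma prob_departures_queue v E n x : iid_past E n ->
  pr (E `&` past_window dep n v `&` queue_event n x) =
  pr E * \prod_(j <- v) pA j * ber_geom_pmf c g x.
Proof.
case: (bal) (queue_ber_itv bal) (queue_geom_itv bal) => hp hq ha hb _ _ hc hg.
elim: v E n x => [|j v IH] E n x iE; have [mE _] := iE.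
  by rewrite /= setIT big_nil mulr1 prob_queue_event.
set F := E `&` _ `&` _.
have mW m : measurable (past_window dep m v) by exact: measurable_past_window.
have mF : measurable F.
  apply: measurableI; last exact: measurable_queue_event.
  exact/measurableI/measurable_past_window.
have sumF k : (forall w, F w -> (a (n - 1) w < k)%N) ->
    pr F = \sum_(i < k) pr (F `&` a (n - 1) @^-1` [set (i : nat)]).
  move=> Fk; rewrite -prob_sum_fibers//; congr pr; apply/seteqP; split => w.
    by move=> Fw; split => //; exact: Fk.
  by case.
have step i l y : pr (E `&` slot_pair a s (n - 1) @^-1` [set (i, l)]
      `&` past_window dep (n - 1) v `&` queue_event (n - 1) y) =
    pr E * \prod_(j <- v) pA j * (pA i * ber_geom_pmf c g y) * pS l.
  rewrite IH; last exact: iid_past_step.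
  by rewrite (iid_past_prob i l iE); ring.
have FE w : F w <-> [/\ E w, past_window dep (n - 1) v w &
    queue_event n x w /\ departures (ereal_path (a ^~ w)) (ereal_path (s ^~ w))
      (n - 1) = (j%:R)%:E :> \bar R].
  rewrite /F /= depE; split => [[[Ew [-> Ww]] Qw]//|[Ew Ww [Qw [/eqP]]]].
  by rewrite eqr_nat => /eqP ej.
have conv k : \sum_(i < k.+1) pA i * ber_geom_pmf c g (k - i) =
    ber_geom_pmf (c + p - c * p) g k.
  rewrite -(queue_arrival_conv bal) (reindex_inj rev_ord_inj).
  by apply: eq_bigr => i _ /=; rewrite subSS subKn 1?mulrC// -ltnS.
rewrite big_cons; case: x @F mF sumF FE => [|x] F mF sumF FE.
  have G i : (i < j.+1)%N -> pr (F `&` a (n - 1) @^-1` [set i]) =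
      pr E * \prod_(j <- v) pA j * (pA i * ber_geom_pmf c g (j - i)) *
      ber_geom_tail q beta j.
    move=> ij; set H := E `&` a (n - 1) @^-1` [set i] `&`
      past_window dep (n - 1) v `&` queue_event (n - 1) (j - i).
    have mH : measurable H.
      apply: measurableI; last exact: measurable_queue_event.
      by apply: measurableI => //; apply: measurableI => //; exact: ma.
    (* The service is constrained only by $S \ge j$, so its atoms are summed into a tail; for each
       atom the induction hypothesis applies through [step]. *)
    rewrite -(@prob_ber_geom_tail _ _ _ P H (s (n - 1)) mH (ms _) _ q beta);
      rewrite ?mulr_ge0 ?prob_ge0 ?ber_geom_pmf_ge0 ?prodr_ge0//; try lra.
    - congr pr; apply/seteqP; split => w.
        move=> [/FE[Ew Ww [Qw Dw]] ai].
        by have /queue_departure0[_ _ jS Q0] := And3 Qw Dw ai.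
      move=> [[[[Ew ai] Ww] Q0] jS].
      have /queue_departure0[Qw Dw _] := And4 ij ai jS Q0.
      by split => //; apply/FE.
    - by move=> i' _; rewrite ber_geom_pmf_ge0//; lra.
    - move=> l; rewrite -step; congr pr; apply/seteqP; split => w.
        move=> [[[[Ew ai] Ww] Q0] sl]; split => //; split => //; split => //.
        by rewrite /slot_pair /= ai sl.
      by move=> [[[Ew [ai sl]] Ww] Q0]; split.
  rewrite (sumF j.+1); last first.
    by move=> w /FE[Ew Ww [Qw Dw]]; have /queue_departure0[] := And3 Qw Dw (erefl (a (n - 1) w)).
  transitivity (\sum_(i < j.+1) pr E * \prod_(j <- v) pA j *
      (pA i * ber_geom_pmf c g (j - i)) * ber_geom_tail q beta j).
    by apply: eq_bigr => i _; exact: G.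
  rewrite -mulr_suml -mulr_sumr conv -[LHS]mulrA (balance_onestep0 bal); ring.
have G i : (i < (x.+1 + j).+1)%N -> pr (F `&` a (n - 1) @^-1` [set i]) =
    pr E * \prod_(j <- v) pA j * (pA i * ber_geom_pmf c g (x.+1 + j - i)) * pS j.
  move=> ij; rewrite -step; congr pr; apply/seteqP; split => w.
    move=> [/FE[Ew Ww [Qw Dw]] ai].
    have /queue_departureS[_ _ sj Q0] := And3 Qw Dw ai.
    by do 3 split => //; rewrite /slot_pair /= ai sj.
  move=> [[[Ew [ai sj]] Ww] Q0].
  have /queue_departureS[Qw Dw _] := And4 ij ai sj Q0.
  by split => //; apply/FE.
rewrite (sumF (x.+1 + j).+1); last first.
  by move=> w /FE[Ew Ww [Qw Dw]]; have /queue_departureS[] := And3 Qw Dw (erefl (a (n - 1) w)).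
transitivity (\sum_(i < (x.+1 + j).+1) pr E * \prod_(j <- v) pA j *
    (pA i * ber_geom_pmf c g (x.+1 + j - i)) * pS j).
  by apply: eq_bigr => i _; exact: G.
rewrite -mulr_suml -mulr_sumr conv -[LHS]mulrA (balance_onestepS bal); ring.
Qed.

End burke.

(** * Laws of processes from their finite windows *)

Definition nat_process {R : realType} (T : Type) (Y : int -> T -> nat) :
  int -> T -> \bar R := fun n w => ((Y n w)%:R)%:E.

Section path_laws.
Context {d : measure_display} {T : measurableType d} {R : realType}.
Variable P : probability T R.
Implicit Types X Y : int -> T -> nat.
Local Notation pr := (prob P).

Fixpoint past_values Y (n : int) (m : nat) w : seq nat :=
  if m is m'.+1 then Y (n - 1) w :: past_values Y (n - 1) m' w else [::].

Lemma size_past_values Y n m w : size (past_values Y n m w) = m.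
Proof. by elim: m n => [|m IH] n //=; rewrite IH. Qed.

Lemma nth_past_values Y n m w i : (i < m)%N ->
  nth 0%N (past_values Y n m w) i = Y (n - 1 - i%:Z) w.
Proof.
elim: m n i => [|m IH] n [|i] //= im; first by rewrite subr0.
by rewrite IH//; congr (Y _ w); lia.
Qed.

Lemma past_valuesP Y n v w : past_window Y n v w <-> past_values Y n (size v) w = v.
Proof.
elim: v n => [|x v IH] n //=; split=> [[<- /IH -> //]|[xv /IH vv]].
by split.
Qed.

Lemma discretely_measurable_past_values Y n m :
  (forall k, discretely_measurable (Y k)) ->
  discretely_measurable (past_values Y n m).
Proof.
move=> mY; elim: m n => [|m IH] n /=.
  exact: (@discretely_measurable_comp _ _ _ _ (fun=> [::]) (Y n)).
apply: (@discretely_measurable_comp _ _ _ _ (fun u => u.1 :: u.2)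
  (fun w => (Y (n - 1) w, past_values Y (n - 1) m w))).
exact: discretely_measurable_pair.
Qed.

Lemma measurable_nat_process Y n : discretely_measurable (Y n) ->
  measurable_fun setT (nat_process Y n : T -> \bar R).
Proof.
move=> mY _ B _; rewrite setTI.
exact: (mY [set k | B ((k%:R)%:E)]).
Qed.

(* Sets of paths that depend on finitely many coordinates form a pi-system
   generating the product sigma-algebra. *)
Definition local_paths (B : set (int -> \bar R)) : Prop :=
  exists l : nat, forall x y, (forall k : int, (absz k <= l)%N -> x k = y k) ->
    B x -> B y.

Lemma local_pathsI : setI_closed local_paths.
Proof.
move=> B C [l hB] [m hC]; exists (maxn l m) => x y xy [Bx Cx].
split; [apply: (hB x)|apply: (hC x)] => // k kl; apply: xy.
  exact: leq_trans (leq_maxl _ _).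
exact: leq_trans (leq_maxr _ _).
Qed.

Lemma path_measurable_local :
  @path_measurable R `<=` <<s local_paths >>.
Proof.
apply: smallest_sub; first exact: smallest_sigma_algebra.
move=> _ [n _ [B mB <-]]; apply: sub_sigma_algebra.
by exists (absz n) => x y xy /=; rewrite xy.
Qed.

(** By Dynkin's theorem it suffices to treat sets depending on finitely many coordinates. Such a set
    is a condition on a list of past values, and lists form a countable type whose atoms are
    windows. *)
Lemma same_law_windows X Y :
  (forall k, discretely_measurable (X k)) ->
  (forall k, discretely_measurable (Y k)) ->
  (forall n v, pr (past_window X n v) = pr (past_window Y n v)) ->
  same_law P (nat_process X) (nat_process Y).
Proof.
move=> mX mY XY; split=> [n|n|B /path_measurable_local].
- exact: measurable_nat_process.
- exact: measurable_nat_process.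
pose G := [set B : set (int -> \bar R) |
  [/\ measurable [set w | B (nat_process X ^~ w)],
      measurable [set w | B (nat_process Y ^~ w)] &
      P [set w | B (nat_process X ^~ w)] = P [set w | B (nat_process Y ^~ w)]]].
suff : <<s local_paths >> `<=` G by move=> h /h[].
apply: lambda_system_subset => //; first exact: local_pathsI.
- apply/dynkin_lambda_system; split.
  + by split => //=; exact: measurableT.
  + move=> C [mCX mCY e]; split; [exact: measurableC|exact: measurableC|].
    have := probability_setC P mCX; have := probability_setC P mCY.
    by rewrite -e => <- <-.
  + move=> F tF GF; split.
    * by apply: bigcupT_measurable => k; have [] := GF k.
    * by apply: bigcupT_measurable => k; have [] := GF k.
    * have dec (Z : int -> T -> nat) :
          (forall k, measurable [set w | F k (nat_process Z ^~ w)]) ->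
          P [set w | (\bigcup_k F k) (nat_process Z ^~ w)] =
          (\sum_(k <oo) P [set w | F k (nat_process Z ^~ w)])%E.
        move=> mZ; rewrite -measure_semi_bigcup//.
          apply/trivIsetP => i j _ _ ij; apply/seteqP; split => w //= Fij.
          by move/trivIsetP : tF => /(_ i j I I ij) /seteqP[h _]; exact: (h _ Fij).
        exact: bigcupT_measurable.
      rewrite !dec; first last.
      + by move=> k; have [] := GF k.
      + by move=> k; have [] := GF k.
      by apply: eq_eseriesr => k _; have [] := GF k.
- move=> C [l hl].
  (* The [m] slots before time [n] are exactly the times from $-l$ to $l$. *)
  pose n : int := l.+1%:Z; pose m := l.*2.+1.
  pose to_path (v : seq nat) : int -> \bar R :=
    fun k => ((nth 0%N v (absz (n - 1 - k)%R))%:R)%:E.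
  have agree (Z : int -> T -> nat) w k : (absz k <= l)%N ->
      to_path (past_values Z n m w) k = nat_process Z k w.
    move=> kl; rewrite /to_path nth_past_values; last by rewrite /m /n; lia.
    by rewrite /nat_process; congr ((Z _ w)%:R%:E); rewrite /n; lia.
  have CE (Z : int -> T -> nat) : [set w | C (nat_process Z ^~ w)] =
      past_values Z n m @^-1` [set v | C (to_path v)].
    apply/seteqP; split => w /=; apply: hl => k kl; first by rewrite agree.
    by rewrite agree.
  have mP := discretely_measurable_past_values.
  split; rewrite ?CE; [exact: mP|exact: mP|].
  rewrite !probK; [|exact: mP|exact: mP]; congr EFin.
  have := @prob_atoms _ _ _ P _ (past_values X n m) (past_values Y n m)
    setT 1 measurableT (mP _ _ _ mX) (mP _ _ _ mY) ler01 _ [set v | C (to_path v)].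
  rewrite setTI mul1r; apply => v; rewrite setTI mul1r.
  have [sv|sv] := eqVneq (size v) m.
    have fib (Z : int -> T -> nat) :
        past_values Z n m @^-1` [set v] = past_window Z n v.
      by apply/seteqP; split => w; rewrite past_valuesP sv.
    by rewrite !fib.
  have fib (Z : int -> T -> nat) : past_values Z n m @^-1` [set v] = set0.
    apply/seteqP; split => w // e; case/negP: sv.
    by rewrite -e size_past_values.
  by rewrite !fib.
Qed.

End path_laws.

Section independent_windows.
Context {d : measure_display} {T : measurableType d} {R : realType}.
Variable P : probability T R.
Variable Y : int -> T -> nat.
Local Notation pr := (prob P).
Local Notation proc := (nat_process Y : int -> T -> \bar R).

Lemma sigma_var_atom n x : sigma_var (proc n) (Y n @^-1` [set x]).
Proof.
exists [set (x%:R)%:E]; first exact: emeasurable_set1.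
rewrite setTI; apply/seteqP; rewrite /nat_process; split => w /=; last by move=> ->.
by move=> [/eqP]; rewrite eqr_nat => /eqP.
Qed.

Lemma sigma_process_window n v : sigma_process proc (past_window Y n v).
Proof.
elim: v n => [|x v IH] n /=.
  exact: (@measurableT _ (g_sigma_algebraType (\bigcup_n sigma_var (proc n)))).
apply: (@measurableI _ (g_sigma_algebraType (\bigcup_n sigma_var (proc n)))).
  by apply: sub_sigma_algebra; exists (n - 1) => //; exact: sigma_var_atom.
exact: IH.
Qed.

Lemma prob_iid_window (p a : R) n v : iid_ber_geom P setT p a proc ->
  pr (past_window Y n v) = \prod_(x <- v) ber_geom_pmf p a x.
Proof.
move=> [[msub indep] law].
(* The claim carries along events at times from [n] on. Each entry of the window becomes one more of
   them, so independence is invoked once, for the whole finite family. *)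
suff h (J : {fset int}) (E : int -> set T) :
    (forall k, k \in J -> n <= k /\ sigma_var (proc k) (E k)) ->
    P (past_window Y n v `&` \bigcap_(k in [set` J]) E k) =
    ((\prod_(x <- v) ber_geom_pmf p a x)%:E * \prod_(k <- J) P (E k))%E.
  have := h fset0 (fun=> setT).
  rewrite set_fset0 bigcap_set0 setIT big_seq_fset0 mule1 => e.
  by rewrite /prob e//= => k; rewrite in_fset0.
elim: v n J E => [|x v IH] n J E hJ.
  rewrite setTI big_nil mul1e indep// => k /hJ[].
  by [].
rewrite /= setIAC.
have nJ : n - 1 \notin J by apply/negP => /hJ[]; lia.
pose E' k := if k == n - 1 then Y (n - 1) @^-1` [set x] else E k.
have E'J k : k \in J -> E' k = E k.
  by rewrite /E'; case: eqVneq => // -> h; rewrite h in nJ.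
have -> : Y (n - 1) @^-1` [set x] `&` \bigcap_(k in [set` J]) E k =
    \bigcap_(k in [set` ((n - 1) |` J)%fset]) E' k.
  rewrite set_fsetU1 bigcap_setU1 {1}/E' eqxx; congr (_ `&` _).
  by apply: eq_bigcapr => k /E'J.
rewrite setIC IH; last first.
  move=> k; rewrite in_fset1U => /predU1P[->|kJ].
    by split => //; rewrite /E' eqxx; exact: sigma_var_atom.
  by rewrite E'J//; have [nk ?] := hJ _ kJ; split => //; lia.
rewrite big_fsetU1//= {1}/E' eqxx big_cons.
have -> : P (Y (n - 1) @^-1` [set x]) = (ber_geom_pmf p a x)%:E.
  have [_ <-] := law (n - 1) I; congr (P _); apply/seteqP.
  rewrite /nat_process; split => w /=; first by move=> ->.
  by move=> [/eqP]; rewrite eqr_nat => /eqP.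
rewrite [in RHS]mulrC EFinM muleA; congr (_ * _)%E.
by apply: eq_big_seq => k /E'J ->.
Qed.

End independent_windows.

(** * Queues in tandem *)

Section queue_length_law.
Context {d : measure_display} {T : measurableType d} {R : realType}.
Variables (a s : int -> T -> nat).
Hypotheses (ma : forall n, discretely_measurable (a n)).
Hypotheses (ms : forall n, discretely_measurable (s n)).

Definition queue_length_var n w : \bar R :=
  queue_length (ereal_path (a ^~ w)) (ereal_path (s ^~ w)) n.

Local Notation Q := (queue_event (R := R) a s).

(** The queue length takes values in the naturals and $+\infty$. Coding these in [option nat] makes
    it a map into a countable type, determined by its atoms. *)
Let code (x : \bar R) : option nat :=
  if x is r%:E then Some (Num.truncn r) else None.
Let decode (o : option nat) : \bar R := if o is Some x then (x%:R)%:E else +oo%E.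

Let codeK n w : decode (code (queue_length_var n w)) = queue_length_var n w.
Proof.
rewrite /queue_length_var.
by have [->|[x ->]] := queue_length_dichotomy (R := R) (a ^~ w) (s ^~ w) n;
  rewrite //= natrK.
Qed.

Let code_fiber n x : (code \o queue_length_var n) @^-1` [set Some x] = Q n x.
Proof.
apply/seteqP; split => w; rewrite /queue_event /=.
  by move=> e; have := codeK n w; rewrite e.
by rewrite /queue_length_var => ->; rewrite /= natrK.
Qed.

Let code_infty n : (code \o queue_length_var n) @^-1` [set None] =
  ~` \bigcup_x Q n x.
Proof.
apply/seteqP; split => w /=.
  by move=> e [x _]; rewrite -code_fiber /= e.
move=> h; case e : code => [x|//]; case: h; exists x => //.
by rewrite -code_fiber.
Qed.

Let mcode n : discretely_measurable (code \o queue_length_var n).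
Proof.
apply: discretely_measurable_fiber => -[x|].
  by rewrite code_fiber; exact: measurable_queue_event.
rewrite code_infty; apply/measurableC/bigcupT_measurable => x.
exact: measurable_queue_event.
Qed.

Let preimage_code n B : queue_length_var n @^-1` B =
  (code \o queue_length_var n) @^-1` (decode @^-1` B).
Proof. by apply/seteqP; split => w /=; rewrite codeK. Qed.

Lemma measurable_queue_length_var n : measurable_fun setT (queue_length_var n).
Proof. by move=> _ B _; rewrite setTI preimage_code; exact: mcode. Qed.

Lemma measurable_departures (dep : int -> T -> nat) n :
  (forall w, departures (ereal_path (a ^~ w)) (ereal_path (s ^~ w)) n =
     ((dep n w)%:R)%:E :> \bar R) ->
  discretely_measurable (dep n).
Proof.
move=> depE.
have -> : dep n = (fun u : option nat * (nat * nat) =>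
    if u.1 is Some x then minn (x + u.2.1) u.2.2 else u.2.2) \o
    (fun w => (code (queue_length_var n w), slot_pair a s n w)).
  apply/funext => w /=.
  suff /eqP : ((dep n w)%:R : R)%:E = ((if code (queue_length_var n w)
      is Some x then minn (x + a n w) (s n w) else s n w)%:R)%:E.
    by rewrite eqe eqr_nat => /eqP.
  rewrite -depE /queue_length_var.
  have [e|[x e]] := queue_length_dichotomy (R := R) (a ^~ w) (s ^~ w) n.
    by rewrite /departures e /= addye// minye.
  by rewrite (departures_nat e) e /= natrK.
apply: discretely_measurable_comp; apply: discretely_measurable_pair.
  exact: mcode.
exact: discretely_measurable_pair.
Qed.

Context (P : probability T R) (p q alpha beta : R).
Hypothesis bal : stable_balance p q alpha beta.
Local Notation pr := (prob P).
Local Notation c := (queue_ber alpha beta).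
Local Notation g := (queue_geom alpha beta).

(** The product formula on finite atoms extends to all events once the atom $+\infty$ is null. It
    is, because it is disjoint from $X_n \le y$, whose probability tends to 1. *)
Lemma queue_length_independent E F n k :
  iid_past P p q alpha beta a s setT n ->
  measurable F -> 0 <= k ->
  (forall x, pr (F `&` Q n x) = k * ber_geom_pmf c g x) ->
  sigma_var (queue_length_var n) E -> pr (F `&` E) = k * pr E.
Proof.
move=> iT mF k0 FQ [B _ <-]; rewrite setTI preimage_code.
apply: prob_atoms => //.
have atom x : pr (Q n x) = ber_geom_pmf c g x.
  by have := prob_queue_event bal ma ms x iT; rewrite setTI probT mul1r.
move=> [x|]; first by rewrite code_fiber FQ atom.
case: (bal) (queue_ber_itv bal) (queue_geom_itv bal) => hp hq ha hb _ _ hc hg.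
suff null : pr ((code \o queue_length_var n) @^-1` [set None]) = 0.
  rewrite null mulr0; apply/eqP; rewrite eq_le prob_ge0 andbT -null.
  by apply: le_prob; [apply: measurableI => //; exact: mcode|exact: mcode|move=> w []].
apply/eqP; rewrite eq_le prob_ge0 andbT; apply/ler_addgt0Pl => e e0.
have [y _ /(_ y.+1 (leqnSn y)) ty] :=
  @ber_geom_tail_cvg0 R c g e ltac:(lra) ltac:(lra) e0.
rewrite addr0; apply: (le_trans _ (ltW ty)).
have := prob_queue_at_most bal ma ms y iT.
rewrite setTI probT mul1r /ber_geom_cdf => Ly.
have mL := measurable_queue_at_most ma ms n y.
have : pr (((code \o queue_length_var n) @^-1` [set None]) `|`
    queue_at_most a s n y) <= 1.
  by rewrite -(probT P); apply: le_prob => //; apply: measurableU => //; exact: mcode.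
rewrite probU//; [|exact: mcode|].
  by rewrite Ly; lra.
apply/seteqP; split => w //= [+ /(@queue_length_le R)].
rewrite /queue_length_var.
have [->|[x ->]] := queue_length_dichotomy (R := R) (a ^~ w) (s ^~ w) n => //=.
Qed.

End queue_length_law.

(** * Induction along the tandem *)

Section tandem_law.
Context {d : measure_display} {T : measurableType d} {R : realType}.
Context (P : probability T R) (N : nat) (p q alpha beta : R).
Context (A : int -> {RV P >-> nat}) (S : nat -> int -> {RV P >-> nat}).
Hypothesis bal : stable_balance p q alpha beta.
Hypothesis indepS :
  mutual_independence P (queues N) (fun r => sigma_process (counts (S r))).
Hypothesis iidS :
  forall r, queues N r -> iid_ber_geom P setT q beta (counts (S r)).
Hypothesis iidA : iid_ber_geom P setT p alpha (counts A).
Hypothesis indepAS : independence P (sigma_process (counts A))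
  <<s \bigcup_(r in queues N) sigma_process (counts (S r)) >>.
Local Notation pr := (prob P).
Local Notation pA := (ber_geom_pmf p alpha).
Local Notation c := (queue_ber alpha beta).
Local Notation g := (queue_geom alpha beta).
Local Notation dep_ereal r := (tandem_departures (counts A) (fun i => counts (S i)) r).
Local Notation queue_ereal r :=
  (tandem_queue_length (counts A) (fun i => counts (S i)) r).
Local Notation Sn r := (fun n => S r n : T -> nat).

Lemma tandem_departures_natural r :
  {D : int -> T -> nat | dep_ereal r = nat_process D}.
Proof.
apply: cid; elim: r => [|r [D hD]]; first by exists (fun n => A n).
have nat_dep n w : exists k, dep_ereal r.+1 n w = (k%:R)%:E.
  by rewrite /= hD; exact: departures_natural.
exists (fun n w => projT1 (cid (nat_dep n w))).
apply/funext => n; apply/funext => w.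
by rewrite /nat_process; case: cid.
Qed.

Let D r := projT1 (tandem_departures_natural r).

Let DE r : dep_ereal r = nat_process (D r).
Proof. exact: projT2 (tandem_departures_natural r). Qed.

Let D_step r n w :
  departures (ereal_path (D r ^~ w)) (ereal_path (Sn r.+1 ^~ w)) n =
  ((D r.+1 n w)%:R)%:E :> \bar R.
Proof.
by have /(congr1 (fun f => f n w)) := DE r.+1; rewrite /= DE.
Qed.

Let queueE r n : queue_ereal r.+1 n = queue_length_var (D r) (Sn r.+1) n.
Proof. by apply/funext => w; rewrite /tandem_queue_length /= DE. Qed.

Let mRV (X : {RV P >-> nat}) : discretely_measurable X.
Proof. by move=> B; rewrite -[X @^-1` B]setTI; exact: measurable_funP. Qed.

Let mS r n : discretely_measurable (Sn r n).
Proof. exact: mRV. Qed.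

Let mD r n : discretely_measurable (D r n).
Proof.
elim: r n => [|r IH] n.
  suff -> : D 0 n = A n by exact: mRV.
  apply/funext => w; have /(congr1 (fun f => f n w)) := DE 0.
  by rewrite /= /counts /nat_process => -[/eqP]; rewrite eqr_nat => /eqP.
by apply: (measurable_departures IH (mS r.+1)) => w; exact: D_step.
Qed.

(* The events of the induction on [r]: queue lengths at time [n] for the queues
   up to [r], whole service processes for the later ones. *)
Let mixed_event r n (E : nat -> set T) i :=
  if (i <= r)%N then sigma_var (queue_ereal i n) (E i)
  else sigma_process (counts (S i)) (E i).

Let sigma_var_measurable r n E :
  sigma_var (queue_ereal r.+1 n) E -> measurable E.
Proof.
rewrite queueE => -[B mB <-].
exact: (@measurable_queue_length_var _ _ R _ _ (mD r) (mS r.+1) n measurableT _ mB).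
Qed.

Let mixed_event_measurable r n E i : queues N i -> mixed_event r n E i ->
  measurable (E i).
Proof.
rewrite /mixed_event => Ni; case: ifP => _; last exact: indepS.1.
by case: i Ni => [//|i] _; exact: sigma_var_measurable.
Qed.

Let measurable_fset_bigcap (J : {fset nat}) (E : nat -> set T) :
  (forall i, i \in J -> measurable (E i)) ->
  measurable (\bigcap_(i in [set` J]) E i).
Proof. by move=> mE; apply: fin_bigcap_measurable. Qed.

Let mixed_event_pred r n E i : i != r.+1 -> mixed_event r.+1 n E i ->
  mixed_event r n E i.
Proof. by rewrite /mixed_event leq_eqVlt => /negPf -> /=; rewrite ltnS. Qed.

(** The past outputs of queue [r] are i.i.d. with the law of the arrivals, jointly independent of
    the queue lengths so far and of all later services. The window stops before [n] because the
    departure at time [n] is itself computed from the queue length at [n]. *)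
Let tandem_independence_at r n := forall (J : {fset nat}) (E : nat -> set T) v,
  [set` J] `<=` queues N -> (forall i, i \in J -> mixed_event r n E i) ->
  pr (past_window (D r) n v `&` \bigcap_(i in [set` J]) E i) =
  \prod_(x <- v) pA x * \prod_(i <- J) pr (E i).

Let tandem_independence0 n : tandem_independence_at 0 n.
Proof.
move=> J E v JN hE.
have {}hE i : i \in J -> sigma_process (counts (S i)) (E i).
  move=> iJ; have := hE i iJ; rewrite /mixed_event leqn0.
  by have /andP[+ _] := JN i iJ; case: eqVneq => [->|].
have mE i : i \in J -> measurable (E i).
  by move=> iJ; apply: indepS.1 (hE i iJ); exact: JN.
have D0 : D 0 = (fun n => A n : T -> nat).
  apply/funext => k; apply/funext => w; have /(congr1 (fun f => f k w)) := DE 0.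
  by rewrite /= /counts /nat_process => -[/eqP]; rewrite eqr_nat => /eqP.
have win : sigma_process (counts A) (past_window (D 0) n v).
  by rewrite D0; exact: sigma_process_window.
have events : <<s \bigcup_(r in queues N) sigma_process (counts (S r)) >>
    (\bigcap_(i in [set` J]) E i).
  pose G := \bigcup_(r in queues N) sigma_process (counts (S r)).
  apply: (@fin_bigcap_measurable _ (g_sigma_algebraType G) _ [set` J] E) => //.
  by move=> i iJ; apply: sub_sigma_algebra; exists i; [exact: JN|exact: hE].
have [subA _ /(_ _ _ win events) e] := indepAS.
rewrite /prob e indepS.2// -/(prob P _).
rewrite (eq_big_seq (fun i => (pr (E i))%:E)); last first.
  by move=> i iJ; rewrite probK//; exact: mE.
rewrite prodEFin fineM//; last by rewrite fin_num_measure//; exact: subA.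
by congr (_ * _); rewrite -(prob_iid_window n v iidA) D0.
Qed.

Let tandem_iid_past r n (J : {fset nat}) (E : nat -> set T) :
  tandem_independence_at r n -> (r < N)%N -> r.+1 \notin J ->
  [set` J] `<=` queues N -> (forall i, i \in J -> mixed_event r.+1 n E i) ->
  iid_past P p q alpha beta (D r) (Sn r.+1) (\bigcap_(i in [set` J]) E i) n.
Proof.
move=> IH rN rJ JN hE; set F := \bigcap_(i in _) _.
have mF : measurable F.
  by apply: measurable_fset_bigcap => i iJ; apply: mixed_event_measurable (hE i iJ);
    exact: JN.
have ne i : i \in J -> i != r.+1 by apply: contraTneq => ->.
have {}hE i : i \in J -> mixed_event r n E i.
  by move=> iJ; apply: mixed_event_pred (hE i iJ); exact: ne.
split=> // v.
pose W := past_window (Sn r.+1) n (unzip2 v).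
(* The index [r.+1] is free in [J], so the window of services of that queue can be inserted there as
   one more event of the induction hypothesis. *)
pose E' i := if i == r.+1 then W else E i.
have E'J i : i \in J -> E' i = E i by rewrite /E' => /ne /negPf ->.
have -> : F `&` past_window (slot_pair (D r) (Sn r.+1)) n v =
    past_window (D r) n (unzip1 v) `&`
    \bigcap_(i in [set` (r.+1 |` J)%fset]) E' i.
  rewrite set_fsetU1 bigcap_setU1 {1}/E' eqxx (eq_bigcapr E'J) setIA setIC.
  by rewrite past_window_pair.
rewrite IH; first last.
- move=> i; rewrite in_fset1U => /predU1P[->|iJ].
    rewrite /mixed_event ltnn /E' eqxx; exact: sigma_process_window.
  by rewrite /mixed_event E'J//; exact: hE.
- by move=> i; rewrite /= in_fset1U => /predU1P[->|/JN//].
rewrite big_fsetU1//= {1}/E' eqxx (prob_iid_window _ _ (iidS _))//.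
have -> : \prod_(i <- J) pr (E' i) = \prod_(i <- J) pr (E i).
  by apply: eq_big_seq => i /E'J ->.
have := IH J E [::] JN hE; rewrite /= setTI big_nil mul1r -/F => ->.
by rewrite big_split !big_map /=; ring.
Qed.

Let tandem_iid_pastT r n : tandem_independence_at r n -> (r < N)%N ->
  iid_past P p q alpha beta (D r) (Sn r.+1) setT n.
Proof.
move=> IH rN; have := @tandem_iid_past r n fset0 (fun=> setT) IH rN.
by rewrite set_fset0 bigcap_set0; apply; rewrite ?in_fset0.
Qed.

Lemma tandem_independence r n : (r <= N)%N -> tandem_independence_at r n.
Proof.
elim: r => [|r IH] rN; first exact: tandem_independence0.
have {}IH := IH (ltnW rN).
(* [B] concerns the queue length of queue [r.+1]: it will be [E r.+1] if that index lies in [J], and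
   the whole space otherwise. The remaining events serve as the conditioning under which Burke's
   property is applied. *)
have key (J : {fset nat}) (E : nat -> set T) B v : r.+1 \notin J ->
    [set` J] `<=` queues N -> (forall i, i \in J -> mixed_event r.+1 n E i) ->
    sigma_var (queue_ereal r.+1 n) B ->
    pr (past_window (D r.+1) n v `&` (B `&` \bigcap_(i in [set` J]) E i)) =
    \prod_(x <- v) pA x * (pr B * \prod_(i <- J) pr (E i)).
  move=> rJ JN hE hB.
  have iF := tandem_iid_past IH rN rJ JN hE.
  have i0 := tandem_iid_pastT IH rN.
  set F := \bigcap_(i in _) _ in iF *; have [mF _] := iF.
  have -> : pr B * \prod_(i <- J) pr (E i) = pr B * pr F.
    congr (_ * _); rewrite -[RHS](congr1 pr (setTI F)).
    have /= -> := IH J E [::] JN; first by rewrite big_nil mul1r.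
    move=> i iJ; apply: mixed_event_pred (hE i iJ).
    by apply: contraTneq iJ => ->.
  rewrite queueE in hB; rewrite [B `&` F]setIC setIA [_ `&` F]setIC.
  rewrite (queue_length_independent (mD r) (mS r.+1) bal
    (k := pr F * \prod_(x <- v) pA x) _ _ _ _ hB).
  - by ring.
  - exact: i0.
  - by apply: measurableI => //; exact: measurable_past_window.
  - apply: mulr_ge0; first exact: prob_ge0.
    by case: bal => *; apply: prodr_ge0 => x _; apply: ber_geom_pmf_ge0; lra.
  - move=> x; exact: (prob_departures_queue bal (mD r) (mS r.+1) (mD r.+1) (D_step r)).
move=> J E v JN hE; have [rJ|rJ] := boolP (r.+1 \in J); last first.
  have := key J E setT v rJ JN hE; rewrite setTI probT mul1r; apply.
  by exists setT => //; rewrite setTI preimage_setT.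
have := key (J `\ r.+1)%fset E (E r.+1) v.
rewrite set_fsetD1 -bigcap_setU1 setD1K//= => ->.
- by rewrite (big_fsetD1 r.+1 rJ).
- by rewrite !inE eqxx.
- by move=> i [/JN].
- by move=> i; rewrite !inE => /andP[_ /hE].
- by have := hE _ rJ; rewrite /mixed_event leqnn.
Qed.

Lemma tandem_departures_law r : queues N r ->
  same_law P (dep_ereal r) (counts A).
Proof.
move=> /andP[_ rN]; rewrite DE; apply: same_law_windows => [k|k|n v].
- exact: mD.
- exact: mRV.
have hE : forall i, i \in (fset0 : {fset nat}) -> mixed_event r n (fun=> setT) i.
  by move=> i; rewrite in_fset0.
have := tandem_independence rN v _ hE.
rewrite set_fset0 bigcap_set0 setIT big_seq_fset0 mulr1 => -> //.
by rewrite (prob_iid_window n v iidA).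
Qed.

Lemma tandem_queue_length_iid n :
  iid_ber_geom P (queues N) c g (fun r => queue_ereal r n).
Proof.
split; first split.
- by case=> [//|r] _ E; exact: sigma_var_measurable.
- move=> J E JN hE.
  (* At [r] equal to [N] all events in the family are queue-length events, and the empty window
     contributes the factor 1. *)
  have hE' i : i \in J -> mixed_event N n E i.
    by move=> iJ; have /andP[_ iN] := JN i iJ; rewrite /mixed_event iN; exact: hE.
  have mE i : i \in J -> measurable (E i).
    by move=> iJ; apply: mixed_event_measurable (hE' i iJ); exact: JN.
  have := tandem_independence (leqnn N) [::] JN hE'.
  rewrite /= setTI big_nil mul1r => e.
  rewrite probK ?e; last exact: measurable_fset_bigcap.
  rewrite -prodEFin; apply: eq_big_seq => i iJ.
  by rewrite probK//; exact: mE.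
case=> [//|r] /andP[_ rN].
have iT := tandem_iid_pastT (tandem_independence (n := n) (ltnW rN)) rN.
split; first by rewrite queueE; exact: measurable_queue_length_var.
move=> k; rewrite queueE -[X in P X]/(queue_event (D r) (Sn r.+1) n k).
rewrite probK; last exact: measurable_queue_event.
have := prob_queue_event bal (mD r) (mS r.+1) k iT.
by rewrite setTI probT mul1r => ->.
Qed.

End tandem_law.

Theorem theorem4p2 (d : measure_display) (T : measurableType d) (R : realType)
    (P : probability T R) (N : nat) (p q alpha beta : R)
    (A : int -> {RV P >-> nat}) (S : nat -> int -> {RV P >-> nat}) :
  (1 <= N)%N ->
  0 < p < 1 -> 0 < q < 1 -> 0 < alpha < 1 -> 0 < beta < 1 ->
  p * beta < q * alpha ->
  alpha / (1 - alpha) * (p / (1 - p)) = beta / (1 - beta) * (q / (1 - q)) ->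
  mutual_independence P (queues N) (fun r => sigma_process (counts (S r))) ->
  (forall r, queues N r -> iid_ber_geom P setT q beta (counts (S r))) ->
  iid_ber_geom P setT p alpha (counts A) ->
  independence P (sigma_process (counts A))
    <<s \bigcup_(r in queues N) sigma_process (counts (S r)) >> ->
  (forall r, queues N r ->
     same_law P (tandem_departures (counts A) (fun r => counts (S r)) r)
       (counts A)) /\
  (forall n : int,
     iid_ber_geom P (queues N)
       (beta / (1 - beta) * ((1 - alpha) / alpha))
       ((alpha - beta) / (1 - beta))
       (fun r => tandem_queue_length (counts A) (fun r => counts (S r)) r n)).
Proof.
move=> _ hp hq ha hb hlt heq indepS iidS iidA indepAS.
have bal := StableBalance hp hq ha hb hlt heq.
split=> [r|n]; first exact: (tandem_departures_law bal indepS iidS iidA indepAS).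
exact: (tandem_queue_length_iid bal indepS iidS iidA indepAS).
Qed.
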